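(* Let $\mathcal P=\{P_C(\mathbf x_C;\mathrm dx_A);\,C\in\mathcal C\}$ be a $\mathcal C$-transition system and let $\nu$ be a probability measure on $(E,\mathcal E)$. Let $\Omega=E^{\mathcal A}$ be the canonical space endowed with its $\sigma$-field $\mathcal F$ generated by the coordinate maps, let $X$ be the canonical process $X_A(\omega)=\omega(A)$, and let $(\mathcal F_A)_{A\in\mathcal A}$ be its natural filtration. Then there exists a unique probability measure $\mathbb P_\nu$ on $(\Omega,\mathcal F)$ such that $X$ is a $\mathcal C$-Markov process w.r.t. $(\mathcal F_A)_{A\in\mathcal A}$ whose initial measure and $\mathcal C$-transition system are $\nu$ and $\mathcal P$ respectively, i.e. $X_{\emptyset'}\sim\nu$ and $$\mathbb P_\nu(X_A\in\Gamma\mid\mathcal G^*_C)=P_C(\mathbf X_C;\Gamma)\quad\mathbb P_\nu\text{-a.s.}$$ for all $C=A\setminus B\in\mathcal C$ and all $\Gamma\in\mathcal E$.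
   Context: Indexing collection. $\mathcal T$ is a locally compact metric space and $(E,d_E)$ is a locally compact separable metric space with Borel $\sigma$-field $\mathcal E$. The indexing collection $\mathcal A$ is a class of compact subsets of $\mathcal T$ such that: (i) $\mathcal A$ is closed under arbitrary intersections and $A^\circ\neq A$ for all $A\in\mathcal A$, $A\neq\mathcal T$; (ii) $\emptyset':=\bigcap_{A\in\mathcal A}A$ is nonempty; (iii) there is an increasing sequence $(B_n)_{n\in\mathbf N}$ in $\mathcal A$ with $\mathcal T=\bigcup_nB_n$; (iv) (Shape) if $A,A_1,\dots,A_k\in\mathcal A$ and $A\subseteq\bigcup_{i=1}^kA_i$ then $A\subseteq A_i$ for some $i$. Increments. $\mathcal A(u)$ is the class of (nonempty) finite unions of sets of $\mathcal A$, and $\mathcal C$ is the class of increments $C=A\setminus B$, $A\in\mathcal A$, $B\in\mathcal A(u)$. To $C$ one associates $A$ and $B$ with $C=A\setminus B$, $B\subseteq A$, $B=\bigcup_{i=1}^kA_i$ being the extremal representation ($A_i\in\mathcal A$, $A_i\not\subseteq A_j$ for $i\ne j$). Let $\mathcal A_\ell$ be the set of all intersections of nonempty subfamilies of $\{A_1,\dots,A_k\}$, and $\mathcal A_C=\{U\in\mathcal A_\ell;\ U\not\subseteq B^\circ\}=\{U_C^1,\dots,U_C^p\}$, $p=|\mathcal A_C|$. For a process $X$, $\mathbf X_C=(X_{U_C^1},\dots,X_{U_C^p})$; similarly $\mathbf x_C=(x_{U_C^1},\dots,x_{U_C^p})\in E^{|\mathcal A_C|}$. Filtrations. The natural filtration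 of $X$ is $\mathcal F_A=\sigma(\{X_V;V\subseteq A,V\in\mathcal A\})$; filtrations are always supposed complete. For $B\in\mathcal A(u)$, $\mathcal F_B=\bigvee_{A\in\mathcal A,A\subseteq B}\mathcal F_A$, and for $C\in\mathcal C$, $\mathcal G^*_C=\bigvee_{B\in\mathcal A(u),\,B\cap C=\emptyset}\mathcal F_B$. $\mathcal C$-Markov property. An $E$-valued process $X=\{X_A;A\in\mathcal A\}$ is $\mathcal C$-Markov w.r.t. $(\mathcal F_A)$ if it is adapted and, for all $C=A\setminus B\in\mathcal C$ and all bounded measurable $f:E\to\mathbf R$, $\mathbb E[f(X_A)\mid\mathcal G^*_C]=\mathbb E[f(X_A)\mid\mathbf X_C]$ a.s. $\mathcal C$-transition system. A collection $\mathcal P=\{P_C(\mathbf x_C;\mathrm dx_A);C\in\mathcal C\}$ such that: 1. for all $C\in\mathcal C$, $P_C$ is a transition probability: $P_C(\mathbf x_C;\cdot)$ is a probability measure on $(E,\mathcal E)$ for all $\mathbf x_C\in E^{|\mathcal A_C|}$ and $P_C(\cdot;\Gamma)$ is measurable for all $\Gamma\in\mathcal E$; 2. $P_\emptyset(x;\Gamma)=\delta_x(\Gamma)$ for all $x\in E$, $\Gamma\in\mathcal E$; 3. (Chapman–Kolmogorov) for all $C=A\setminus B\in\mathcal C$ and $A'\in\mathcal A$, with $C'=C\cap A'$ and $C''=C\setminus A'$, $$P_C(\mathbf x_C;\Gamma)=\int_EP_{C'}(\mathbf x_{C'};\mathrm dx_{A'})\,P_{C''}(\mathbf x_{C''};\Gamma)$$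 for all $\mathbf x_C,\mathbf x_{C'},\mathbf x_{C''}$ and $\Gamma\in\mathcal E$. Here components of the three vectors indexed by the same set of $\mathcal A$ are equal; when $A'\subseteq A$ and $A'\not\subseteq B$ one has $A'\in\mathcal A_{C''}$, and the component $x_{A'}$ of $\mathbf x_{C''}$ is the integration variable. If $A'\subseteq B$ or $A\subseteq A'$ then $C'$ or $C''$ is empty and the equation is trivially true; if $A'\not\subseteq A$, $A'$ is to be read as $A\cap A'$, which gives the same $C',C''$. *)

(* Defs.v *)
From HB Require Import structures.
From mathcomp Require Import all_boot all_order all_algebra.
From mathcomp Require Import all_classical all_reals all_analysis.

Set Implicit Arguments.
Unset Strict Implicit.
Unset Printing Implicit Defensive.

Import Order.TTheory GRing.Theory Num.Theory.
Import numFieldNormedType.Exports.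

Local Open Scope classical_set_scope.
Local Open Scope ring_scope.

(* Measurable types are pointed in MathComp-Analysis; for a state space that
   carries a probability measure this is no restriction. *)
#[short(type="pmetricType")]
HB.structure Definition PMetric (K : numDomainType) :=
  {M of Pointed M & Metric K M}.

Definition separable_space (T : topologicalType) : Prop :=
  exists2 D : set T, countable D & dense D.

Definition borel_type (R : numDomainType) (E : pmetricType R) :=
  g_sigma_algebraType (@open E).

Section families_of_maps.
Context {I Omega : Type} {d : measure_display} {E : measurableType d}.

Definition family_preimages (D : set I) (X : I -> Omega -> E) :
    set (set Omega) :=
  \bigcup_(i in D) preimage_set_system setT (X i) measurable.

Definition sigma_of (D : set I) (X : I -> Omega -> E) : set (set Omega) :=
  <<s family_preimages D X >>.

End families_of_maps.

Definition coordinate {I E : Type} (i : I) (w : I -> E) : E := w i.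

(* E^I with the sigma-field generated by the coordinate maps. *)
Definition power_type (I : Type) {d : measure_display} (E : measurableType d) :=
  g_sigma_algebraType (family_preimages setT (@coordinate I E)).

(* Every member contains the nonempty intersection of the collection, so the
   empty set is never a member; for the same reason the intersections in
   [icoll_bigcap] are those of nonempty subfamilies (the ambient space need
   not be compact). *)
Record indexing_collection (T : topologicalType) := IndexingCollection {
  icoll :> set (set T) ;
  icoll_compact : forall A, icoll A -> compact A ;
  icoll_bigcap : forall F : set (set T), F `<=` icoll -> F !=set0 ->
    icoll (\bigcap_(A in F) A) ;
  icoll_interior : forall A, icoll A -> A <> setT -> interior A <> A ;
  icoll_bottom : \bigcap_(A in icoll) A !=set0 ;
  icoll_exhaust : exists B : nat -> set T,
    [/\ forall n, icoll (B n),
        forall m n, (m <= n)%N -> B m `<=` B n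
      & \bigcup_n B n = setT] ;
  icoll_shape : forall (A : set T) (F : set (set T)), icoll A ->
    F `<=` icoll -> finite_set F -> A `<=` \bigcup_(V in F) V ->
    exists2 V, F V & A `<=` V }.

Section increments.
Context {T : topologicalType} (A : indexing_collection T).

Lemma bottom_subproof : \bigcap_(V in A) V \in (A : set (set T)).
Proof.
apply/mem_set/icoll_bigcap => //.
by have [B [AB _ _]] := icoll_exhaust A; exists (B 0%N).
Qed.

Definition bottom : A := exist _ (\bigcap_(V in A) V) bottom_subproof.

Definition finite_unions : set (set T) :=
  [set B | exists F : set (set T),
     [/\ F `<=` A, finite_set F, F !=set0 & B = \bigcup_(V in F) V]].

(* The increment C = outer \ inner, given by its outer set A and by the
   extremal representation {A_1, ..., A_k} of B, with B included in A.
   By Shape, A and the extremal representation are determined by C as soon as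
   C is nonempty; an empty increment still remembers A, and then k = 1 and
   A_1 = A. *)
Record increment := Increment {
  outer : A ;
  extremal : set A ;
  extremal_finite : finite_set extremal ;
  extremal_neq0 : extremal !=set0 ;
  extremal_antichain : forall U V, extremal U -> extremal V ->
    \val U `<=` \val V -> U = V ;
  extremal_sub : forall U, extremal U -> \val U `<=` \val outer }.

Definition inner (c : increment) : set T := \bigcup_(U in extremal c) \val U.

Definition incr_set (c : increment) : set T := \val (outer c) `\` inner c.

Definition incr_meets (c : increment) : set A :=
  [set U | exists G : set A, [/\ G `<=` extremal c, G !=set0
     & \val U = \bigcap_(V in G) \val V]].

(* The set A_C indexing the components of x_C. When C is empty, B = A and the
   first clause gives {A} because A is not open, unless A is the whole space;
   the second clause keeps A_C = {A} in that case too, so that P_empty is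
   always a transition probability from E to E. *)
Definition incr_index (c : increment) : set A :=
  [set U | (incr_meets c U /\ ~ (\val U `<=` interior (inner c))) \/
           (incr_set c = set0 /\ U = outer c)].

End increments.

Section conditional_expectation.
Context {d : measure_display} {Omega : measurableType d} {R : realType}.
Variable P : probability Omega R.

(* Y is a version of E[Z | G], for a sub-sigma-field G and an integrable Z *)
Definition is_cond_exp (G : set (set Omega)) (Z Y : Omega -> R) : Prop :=
  [/\ forall S : set R, measurable S -> G (Y @^-1` S),
      P.-integrable setT (EFin \o Y)
    & forall D, G D ->
        (\int[P]_(w in D) (Y w)%:E = \int[P]_(w in D) (Z w)%:E)%E].

(* E[Z | G] = W a.s. *)
Definition cond_exp_is (G : set (set Omega)) (Z W : Omega -> R) : Prop :=
  exists2 Y, is_cond_exp G Z Y & Y = W %[ae P].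

(* E[Z | G] = E[Z | H] a.s. *)
Definition cond_exp_eq (G H : set (set Omega)) (Z : Omega -> R) : Prop :=
  exists2 Y, is_cond_exp H Z Y & cond_exp_is G Z Y.

End conditional_expectation.

Section markov.
Context {T : topologicalType} {A : indexing_collection T}.
Context {d' : measure_display} {E : measurableType d'}.
Context {d : measure_display} {Omega : measurableType d} {R : realType}.
Variable P : probability Omega R.

(* the natural filtration, completed by the P-null events *)
Definition natural_filtration (X : A -> Omega -> E) (V : A) :
    set (set Omega) :=
  <<s family_preimages [set U : A | \val U `<=` \val V] X `|`
      [set N | measurable N /\ P N = 0%E] >>.

Definition filtration_union (F : A -> set (set Omega)) (B : set T) :
    set (set Omega) :=
  <<s \bigcup_(V in [set V : A | \val V `<=` B]) F V >>.

Definition Gstar (F : A -> set (set Omega)) (c : increment A) :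
    set (set Omega) :=
  <<s \bigcup_(B in [set B | finite_unions A B /\ B `&` incr_set c = set0])
        filtration_union F B >>.

Definition C_Markov (F : A -> set (set Omega)) (X : A -> Omega -> E) : Prop :=
  (forall (V : A) (S : set E), measurable S -> F V (X V @^-1` S)) /\
  (forall (c : increment A) (f : E -> R),
     measurable_fun setT f -> (exists M : R, forall x, `|f x| <= M) ->
     cond_exp_eq P (Gstar F c) (sigma_of (incr_index c) X)
       (f \o X (outer c))).

End markov.

Section transition_systems.
Context {T : topologicalType} (A : indexing_collection T).
Context {d : measure_display} (E : measurableType d) (R : realType).

Definition transition_family : Type :=
  forall c : increment A, R.-pker (power_type (incr_index c) E) ~> E.

(* x_C, for x in E^A *)
Definition incr_restr (c : increment A) (x : A -> E) :
    power_type (incr_index c) E :=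
  sigL (incr_index c) x.
Arguments incr_restr c x : clear implicits.

Definition update (x : A -> E) (V : A) (y : E) : A -> E :=
  fun U => if `[< U = V >] then y else x U.

(* In [tsys_CK], C' = C \cap A' has outer set A \cap A' and C'' = C \ A' has
   outer set A. The three vectors are the restrictions of one x in E^A, which
   says that their components indexed by the same set agree; x_{A \cap A'} is
   the integration variable in x_{C''}. *)
Record is_transition_system (p : transition_family) : Prop := {
  tsys_empty : forall (c : increment A) (x : A -> E) (S : set E),
    incr_set c = set0 -> measurable S ->
    p c (incr_restr c x) S = \d_(x (outer c)) S ;
  tsys_CK : forall (c c1 c2 : increment A) (A' : A) (x : A -> E) (S : set E),
    \val (outer c1) = \val (outer c) `&` \val A' ->
    incr_set c1 = incr_set c `&` \val A' ->
    outer c2 = outer c ->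
    incr_set c2 = incr_set c `\` \val A' ->
    measurable S ->
    p c (incr_restr c x) S =
    (\int[p c1 (incr_restr c1 x)]_y
       p c2 (incr_restr c2 (update x (outer c1) y)) S)%E }.

(* P is a law on the canonical space E^A under which the canonical process is
   C-Markov with initial measure nu and C-transition system p. *)
Definition is_Markov_law (nu : probability E R) (p : transition_family)
    (P : probability (power_type A E) R) : Prop :=
  let X : A -> power_type A E -> E := @coordinate A E in
  let F := natural_filtration P X in
  [/\ C_Markov P F X,
      forall S : set E, measurable S -> P (X (bottom A) @^-1` S) = nu S
    & forall (c : increment A) (S : set E), measurable S ->
        cond_exp_is P (Gstar F c) (\1_(X (outer c) @^-1` S))
          (fun w => fine (p c (incr_restr c (X^~ w)) S))].

End transition_systems.

Arguments incr_restr {T A d E} c x.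

(* Main.v *)
Require Import Defs.
From HB Require Import structures.
From mathcomp Require Import all_boot all_order all_algebra.
From mathcomp Require Import all_classical all_reals all_analysis.
From mathcomp Require Import measurable_realfun lra.
Set Implicit Arguments.
Unset Strict Implicit.
Unset Printing Implicit Defensive.
Import Order.TTheory GRing.Theory Num.Theory.
Import numFieldNormedType.Exports.
Local Open Scope classical_set_scope.
Local Open Scope ring_scope.

(* Fix a finite subset of the collection closed under intersections and list it
   compatibly with inclusion, starting with the bottom set. Each new set U is
   not covered by the previous ones (Shape), so removing them from U leaves an
   increment whose kernel depends on previous coordinates only: drawing the
   bottom coordinate from nu and then one coordinate after the other from these
   kernels gives a law. It does not depend on the order of the list (two
   maximal sets can be exchanged, by Fubini), and dropping a set of the list
   gives the corresponding marginal (list the dropped set just before the least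
   set containing it and apply Chapman-Kolmogorov). Hence the laws are
   consistent and Kolmogorov's extension theorem applies; its compactness
   argument uses that E is sigma-compact. To read off the Markov property for
   an increment C = A minus B and an event depending on finitely many sets which
   miss C, list these sets and the extremal sets of B, closed under
   intersections also with A, and A last. Conversely the Markov property
   determines the finite-dimensional laws by induction on the list. *)

(** * Sets and functions of finitely many coordinates *)

(** Everything lives on the full product E^A: a finite-dimensional law is a probability there with
    its unlisted coordinates at the base point, and marginals are compared on the events that depend
    on given coordinates only. Identifications between different finite products are thus avoided.
    Three obstacles shape the details. A kernel is indexed by a presentation of an increment (outer
    set and extremal family), whereas reordering a list produces other presentations of the same
    set; that they carry the same kernel is itself extracted from Chapman-Kolmogorov and the axiom
    on empty increments. The filtration is completed, so [Gstar] is not generated by coordinate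
    events alone and generating events are handled up to null events. In the extension theorem a
    countable cover may involve infinitely many coordinates, and a compact box has to be fixed in
    all of them before a finite subcover is known. *)

Definition depends_on (I E V : Type) (F : set I) (f : (I -> E) -> V) : Prop :=
  forall x y : I -> E, (forall i, F i -> x i = y i) -> f x = f y.

Lemma depends_onS (I E V : Type) (F G : set I) (f : (I -> E) -> V) :
  F `<=` G -> depends_on F f -> depends_on G f.
Proof. by move=> FG dF x y xy; apply: dF => i /FG; exact: xy. Qed.

Lemma depends_on_mem (I E : Type) (F : set I) (S : set (I -> E)) x y :
  depends_on F S -> (forall i, F i -> x i = y i) -> (x \in S) = (y \in S).
Proof.
move=> dS xy; have Sxy := dS x y xy.
by apply/idP/idP => /set_mem H; apply/mem_set; [rewrite -Sxy|rewrite Sxy].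
Qed.

(* Overwriting the coordinates outside F by the base point of E: a set or
   function depends on F only iff it is invariant under this map. *)
Definition freeze (I : Type) (E : pointedType) (F : set I) (x : I -> E) :
    I -> E :=
  fun i => if `[< F i >] then x i else point.

Section freeze_theory.
Context {I : Type} {E : pointedType} (F : set I).

Lemma freezeE (x : I -> E) i : F i -> freeze F x i = x i.
Proof. by move=> Fi; rewrite /freeze asboolT. Qed.

Lemma freeze_out (x : I -> E) i : ~ F i -> freeze F x i = point.
Proof. by move=> Fi; rewrite /freeze asboolF. Qed.

Lemma depends_on_freeze V (f : (I -> E) -> V) : depends_on F (f \o freeze F).
Proof.
move=> x y xy /=; congr f; apply/funext => i.
by have [Fi|Fi] := pselect (F i); [rewrite !freezeE// xy|rewrite !freeze_out].
Qed.

Lemma freezeK V (f : (I -> E) -> V) : depends_on F f -> f \o freeze F = f.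
Proof. by move=> dF; apply/funext => x; apply: dF => i Fi; rewrite freezeE. Qed.

End freeze_theory.

Section power_measurability.
Context {I : Type} {d : measure_display} {E : measurableType d}.

Lemma measurable_coordinate (i : I) :
  measurable_fun [set: power_type I E] (@coordinate I E i).
Proof.
move=> _ S mS; rewrite setTI; apply: sub_sigma_algebra.
by exists i => //; exists S => //; rewrite setTI.
Qed.

Lemma measurable_to_power d1 (X : measurableType d1)
    (f : X -> power_type I E) :
  (forall i, measurable_fun setT (fun x => f x i)) -> measurable_fun setT f.
Proof.
move=> mf; pose G := family_preimages setT (@coordinate I E).
apply: (@measurability _ _ _ (power_type I E) setT f G) => //.
move=> _ [_ [i _ [S mS <-]] <-]; rewrite !setTI.
by have := mf i measurableT S mS; rewrite setTI.
Qed.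

Lemma measurable_freeze (F : set I) :
  measurable_fun [set: power_type I E] (freeze F : _ -> power_type I E).
Proof.
apply: measurable_to_power => i; rewrite /freeze.
by case: asboolP => _; [exact: measurable_coordinate|exact: measurable_cst].
Qed.

(** [S] is its own preimage under [freeze F], and this map pulls every generator back into
    [sigma_of F]: a coordinate in [F] is kept, any other becomes constant, so that its events become
    empty or full. *)
Lemma depends_on_sigma_of (F : set I) (S : set (power_type I E)) :
  measurable S -> depends_on F S ->
  sigma_of F (@coordinate I E : I -> power_type I E -> E) S.
Proof.
move=> mS dS; rewrite -(freezeK dS : freeze F @^-1` S = S).
pose H := [set B : set (power_type I E) |
  sigma_of F (@coordinate I E : I -> power_type I E -> E) (freeze F @^-1` B)].
suff : measurable `<=` H by exact.
apply: smallest_sub; first split.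
- by rewrite /H /= preimage_set0; exact: sigma_algebra0.
- by move=> B HB; rewrite /H/= setTD preimage_setC; exact: sigma_algebraC.
- by move=> B HB; rewrite /H/= preimage_bigcup; exact: sigma_algebra_bigcup.
move=> _ [i _ [B mB <-]]; rewrite /H/= setTI.
have [Fi|Fi] := pselect (F i).
  apply: sub_sigma_algebra; exists i => //; exists B => //.
  by rewrite setTI; apply/seteqP; split => x /=; rewrite /coordinate freezeE.
have -> : freeze F @^-1` (@coordinate I E i @^-1` B) =
    (fun=> point) @^-1` B :> set (power_type I E).
  by apply/seteqP; split => x /=; rewrite /coordinate freeze_out.
rewrite preimage_cst; case: ifPn => _; last exact: sigma_algebra0.
by rewrite -setC0; apply: sigma_algebraC; exact: sigma_algebra0.
Qed.

End power_measurability.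

Section image_probability.
Context {d1 d2 : measure_display} {T1 : measurableType d1}
  {T2 : measurableType d2} {R : realType}.

Definition image_probability (P : probability T1 R) (f : T1 -> T2)
    (mf : measurable_fun setT f) : set T2 -> \bar R := pushforward P f.

Section instances.
Variables (P : probability T1 R) (f : T1 -> T2) (mf : measurable_fun setT f).

Let m := measure_function_pushforward__canonical__measure_function_Measure P mf.

HB.instance Definition _ := isMeasure.Build _ _ _ (image_probability P mf)
  (measure0 m) (measure_ge0 m) (@measure_semi_sigma_additive _ _ _ m).

Let image_probability_setT : image_probability P mf setT = 1%E.
Proof. by rewrite /image_probability /pushforward preimage_setT probability_setT. Qed.

HB.instance Definition _ := Measure_isProbability.Build _ _ _
  (image_probability P mf) image_probability_setT.

End instances.

Lemma integral_image_probability (P : probability T1 R) (f : T1 -> T2)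
    (mf : measurable_fun setT f) (g : T2 -> \bar R) :
  measurable_fun setT g -> (forall y, (0 <= g y)%E) ->
  (\int[image_probability P mf]_y g y = \int[P]_x g (f x))%E.
Proof. by move=> mg g0; rewrite ge0_integral_pushforward. Qed.

End image_probability.

Section agreement.
Context {I : Type} {d : measure_display} {E : measurableType d} {R : realType}.
Local Notation Omega := (power_type I E).

Definition agree_on (F : set I) (P Q : probability Omega R) : Prop :=
  forall S : set Omega, measurable S -> depends_on F S -> P S = Q S.

(** The images of [P] and [Q] under [freeze F] coincide on the whole sigma-field, and [f] does not
    distinguish a point from its frozen version. *)
Lemma agree_on_integral (F : set I) (P Q : probability Omega R) (f : Omega -> \bar R) :
  agree_on F P Q -> measurable_fun setT f -> (forall x, (0 <= f x)%E) ->
  depends_on F f -> (\int[P]_x f x = \int[Q]_x f x)%E.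
Proof.
move=> PQ mf f0 df.
transitivity (\int[P]_x f (freeze F x))%E; first by rewrite -{1}(freezeK df).
rewrite -(integral_image_probability P (measurable_freeze F) mf f0).
transitivity (\int[Q]_x f (freeze F x))%E; last by rewrite -{2}(freezeK df).
rewrite -(integral_image_probability Q (measurable_freeze F) mf f0).
apply: eq_measure_integral => S mS _; apply: PQ.
  by rewrite -[X in measurable X]setTI; exact: measurable_freeze.
exact: depends_on_freeze.
Qed.

End agreement.

(** * Kolmogorov's extension theorem over a sigma-compact space *)

Section sigma_compact.
Context {R : realType} {E : pmetricType R}.

(** The balls of radius 1/(k+1) about a dense sequence that lie in some compact set cover the space,
    and there are countably many of them; one compact set is chosen for each. *)
Lemma locally_compact_separable_sigma_compact :
  locally_compact [set: E] -> separable_space E ->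
  exists L : (set E)^nat, [/\ forall n, compact (L n), forall n, closed (L n),
    forall n, L n point, nondecreasing_seq L & \bigcup_n L n = setT].
Proof.
move=> lcE [D cD dD].
have [q Dq] : exists q : nat -> E, forall x, D x -> exists n, q n = x.
  have [D0|/set0P[x0 Dx0]] := eqVneq D set0.
    by exists (fun=> point) => x; rewrite D0.
  move/(@pfcard_geP _ _ D [set: nat]) : cD => [D0|[/= g]].
    by exists (fun=> point) => x; rewrite D0.
  by exists g => x Dx; have [n _ <-] := 'surj_g Dx; exists n.
pose good n k := exists2 K : set E, compact K & ball (q n) k.+1%:R^-1 `<=` K.
have [f fP] : {f : nat -> nat -> set E & forall n k, compact (f n k) /\
    (good n k -> ball (q n) k.+1%:R^-1 `<=` f n k)}.
  apply: (@choice _ _ (fun n fn => forall k, compact (fn k) /\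
    (good n k -> ball (q n) k.+1%:R^-1 `<=` fn k))) => n.
  suff /choice[g gP] : forall k, exists K, compact K /\
      (good n k -> ball (q n) k.+1%:R^-1 `<=` K) by exists g.
  move=> k; have [[K cK sK]|ng] := pselect (good n k); first by exists K.
  by exists set0; split => //; exact: compact0.
have fcover x : exists n k, f n k x.
  have [K [Kx [cK clK]]] : exists K : set E, nbhs x K /\ compact K /\ closed K.
    have [K /= wK [cK clK]] := lcE x I.
    by exists K; rewrite withinET in wK.
  move: Kx => /nbhs_ballP[e /= e0 eK].
  have [k ke] : exists k : nat, k.+1%:R^-1 < e / 2.
    exists (Num.truncn (e / 2)^-1); rewrite invf_plt ?posrE ?divr_gt0//.
    by rewrite truncnS_gt.
  have [y [Dy xy]] : D `&` (ball x k.+1%:R^-1)^° !=set0.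
    rewrite setIC; apply: dD; last exact: open_interior.
    by exists x; exact: nbhsx_ballx.
  have [n qn] := Dq y Dy; exists n, k.
  have xy' := interior_subset xy.
  apply: (fP n k).2; last by rewrite qn; exact: ball_sym.
  exists K => // z; rewrite qn => yz; apply: eK.
  rewrite [e]splitr; apply: (@ball_triangle _ _ y).
    by apply: le_ball xy'; exact: ltW.
  by apply: le_ball yz; exact: ltW.
pose h k := if @unpickle (nat * nat)%type k is Some ij then f ij.1 ij.2 else set0.
(* The base point is put into every [L m], so that frozen coordinates never leave a compact box. *)
pose L m := [set point] `|` \big[setU/set0]_(k < m) h k.
have cL n : compact (L n).
  apply: compactU; first exact: compact_set1.
  apply: (big_ind compact); [exact: compact0|exact: compactU|move=> k _].
  by rewrite /h; case: unpickle => [ij|]; [exact: (fP _ _).1|exact: compact0].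
exists L; split => //.
- by move=> n; apply: compact_closed => //; exact: metric_hausdorff.
- by move=> n; left.
- by move=> m n mn; apply/subsetPset; apply: setUS; exact: subset_bigsetU.
- apply/seteqP; split => // x _; have [n [k fx]] := fcover x.
  exists (pickle (n, k)).+1 => //; right.
  by apply: (@bigsetU_sup _ (pickle (n, k))) => //; rewrite /h pickleK.
Qed.

Lemma open_Fsigma (O : set E) : open O ->
  exists C : (set E)^nat, [/\ forall n, closed (C n), nondecreasing_seq C &
    \bigcup_n C n = O].
Proof.
(* C n consists of the points at distance at least 1/(n+1) from ~` O. *)
move=> oO; pose C n := ~` \bigcup_(y in ~` O) (ball y n.+1%:R^-1)^°.
exists C; split.
- by move=> n; apply: open_closedC; apply: bigcup_open => y _; exact: open_interior.
- move=> m n mn; apply/subsetPset; apply: subsetC => x [y Oy yx].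
  exists y => //; apply: interiorS yx; apply: le_ball.
  by rewrite lef_pV2 ?posrE// ler_nat.
- apply/seteqP; split => [x [n _ Cx]|x Ox].
    apply: contrapT => Ox; apply: Cx; exists x => //; exact: nbhsx_ballx.
  have [e /= e0 eO] : exists2 e : R, 0 < e & ball x e `<=` O.
    by apply/nbhs_ballP; exact: open_nbhs_nbhs.
  exists (Num.truncn e^-1) => // -[y Oy /interior_subset yx]; apply: Oy.
  apply: eO; apply: le_ball (ball_sym yx).
  by rewrite invf_ple ?posrE// ltW// truncnS_gt.
Qed.

End sigma_compact.

Lemma nonincreasing_probability_lt d (T : measurableType d) (R : realType)
    (P : probability T R) (F : (set T)^nat) (e : \bar R) :
  (forall n, measurable (F n)) -> nonincreasing_seq F ->
  (P (\bigcap_n F n) < e)%E -> exists n, (P (F n) < e)%E.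
Proof.
move=> mF ndF; apply: contraPP => /forallNP PF; apply/negP; rewrite -leNgt.
have cF : P \o F @ \oo --> P (\bigcap_n F n).
  apply: nonincreasing_cvg_mu => //; last exact: bigcapT_measurable.
  by rewrite (le_lt_trans (probability_le1 P _)) ?ltry.
rewrite -(cvg_lim _ cF)//; apply: lime_ge; first by apply/cvg_ex; eexists; exact: cF.
by apply: nearW => n; rewrite leNgt; apply/negP; exact: PF.
Qed.

(** * Regularity of probabilities on cylinder events *)

Section cylinder_regularity.
Context {R : realType} {E : pmetricType R} {J : choiceType}.
Local Notation Omega := (power_type J (borel_type E)).
Implicit Types F : set J.

(** Measurability and closedness are recorded separately: for uncountable [J] a closed set of the
    product topology may fail to belong to the product sigma-field. *)
Definition closed_cylinder F (C : set Omega) : Prop :=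
  [/\ measurable C, depends_on F C & @closed (prod_topology (fun=> E : topologicalType)) C].

Definition open_cylinder F (U : set Omega) : Prop :=
  [/\ measurable U, depends_on F U & @open (prod_topology (fun=> E : topologicalType)) U].

Lemma closed_cylinderC F (C : set Omega) :
  closed_cylinder F C -> open_cylinder F (~` C).
Proof.
move=> [mC dC cC]; split; [exact: measurableC| |exact: closed_openC].
by move=> x y xy; rewrite /setC/= (dC x y).
Qed.

Lemma open_cylinderC F (U : set Omega) :
  open_cylinder F U -> closed_cylinder F (~` U).
Proof.
move=> [mO dO oO]; split; [exact: measurableC| |exact: open_closedC].
by move=> x y xy; rewrite /setC/= (dO x y).
Qed.

Lemma open_cylinder_bigcup F (U : (set Omega)^nat) :
  (forall n, open_cylinder F (U n)) -> open_cylinder F (\bigcup_n U n).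
Proof.
move=> oO; split.
- by apply: bigcupT_measurable => n; have [] := oO n.
- move=> x y xy; apply/propext; split=> -[n _ Onx]; exists n => //.
    by have [_ dO _] := oO n; rewrite -(dO x y).
  by have [_ dO _] := oO n; rewrite (dO x y).
- by apply: bigcup_open => n _; have [] := oO n.
Qed.

Lemma closed_cylinder_bigsetU F (C : (set Omega)^nat) n :
  (forall n, closed_cylinder F (C n)) ->
  closed_cylinder F (\big[setU/set0]_(i < n) C i).
Proof.
move=> cC; elim/big_ind : _ => //.
- by split; [exact: measurable0| |exact: closed0].
- move=> A B [mA dA cA] [mB dB cB]; split; [exact: measurableU| |exact: closedU].
  by move=> x y xy; rewrite /setU/= (dA x y)// (dB x y).
Qed.

Lemma closed_cylinder_preimage F i (C : set E) : F i -> closed C ->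
  closed_cylinder F (@coordinate J E i @^-1` C).
Proof.
move=> Fi cC; split.
- rewrite -[X in measurable X]setTI; apply: (@measurable_coordinate J _ (borel_type E)) => //.
  rewrite -(setCK C); apply: measurableC; apply: sub_sigma_algebra.
  exact: closed_openC.
- by move=> x y xy; rewrite /preimage/= /coordinate xy.
- apply: (closed_comp _ cC) => x _; exact: (@proj_continuous J (fun=> E : topologicalType) i x).
Qed.

Variable P : probability Omega R.

(** The approximating sets depend on the same coordinates as [S], so their measures can be carried
    from one finite-dimensional law to another. *)
Definition regular_cylinder F (S : set Omega) : Prop :=
  forall e : R, 0 < e -> exists C U, [/\ closed_cylinder F C, open_cylinder F U,
    C `<=` S, S `<=` U & (P (U `\` C) <= e%:E)%E].

Lemma regular_cylinderC F (S : set Omega) :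
  regular_cylinder F S -> regular_cylinder F (~` S).
Proof.
move=> rS e e0; have [C [U [cC oO CS SO OCe]]] := rS e e0.
exists (~` U), (~` C); split; [exact: open_cylinderC|exact: closed_cylinderC| | |].
- exact: subsetC.
- exact: subsetC.
- by rewrite setDE setCK setIC -setDE.
Qed.

Lemma regular_cylinder_bigcup F (S : (set Omega)^nat) :
  (forall n, regular_cylinder F (S n)) -> regular_cylinder F (\bigcup_n S n).
Proof.
move=> rS e e0.
have e2 : 0 < e / 2 by rewrite divr_gt0.
have /choice[C /choice [U CO]]: forall n, exists C U, [/\ closed_cylinder F C,
    open_cylinder F U, C `<=` S n, S n `<=` U &
    (P (U `\` C) <= (e / 2 / (2 ^ n.+1)%:R)%:E)%E].
  by move=> n; apply: rS; rewrite divr_gt0// ltr0n expn_gt0.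
pose UC n := \big[setU/set0]_(i < n) C i.
have mO n : measurable (U n) by have [_ []] := CO n.
have mC n : measurable (C n) by have [[]] := CO n.
have mU : measurable (\bigcup_n U n) by exact: bigcupT_measurable.
have mUC n : measurable (UC n) by exact: bigsetU_measurable.
have capUC : \bigcap_n ((\bigcup_n U n) `\` UC n) =
    (\bigcup_n U n) `\` \bigcup_n C n.
  apply/seteqP; split => [x Hx|x [Ux Cx] n _]; split => //.
  - by have [] := Hx 0%N I.
  - move=> [n _ Cnx]; have [_] := Hx n.+1 I; apply.
    by rewrite /UC big_ord_recr; right.
  - by move=> UCx; apply: Cx; exact: bigsetU_bigcup UCx.
have half : (P ((\bigcup_n U n) `\` \bigcup_n C n) <= (e / 2)%:E)%E.
  apply: (@le_trans _ _ (P (\bigcup_n (U n `\` C n)))).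
    apply: le_measure; rewrite ?inE.
    - by apply: measurableD => //; exact: bigcupT_measurable.
    - by apply: bigcupT_measurable => n; exact: measurableD.
    - move=> x [[n _ Onx] Cx]; exists n => //; split => // Cnx.
      by apply: Cx; exists n.
  apply: (le_trans (@generalized_Boole_inequality _ _ _ P _ _ _)).
  - by move=> n; exact: measurableD.
  - by apply: bigcupT_measurable => n; exact: measurableD.
  apply: (@le_trans _ _ (\sum_(n <oo) (e / 2 / (2 ^ n.+1)%:R)%:E)%E).
    by apply: lee_nneseries => // n _; have [] := CO n.
  by apply: epsilon_trick0; exact: ltW.
(* An infinite union of closed sets need not be closed. The remainders left by finite unions
   decrease to a set of measure at most [e / 2], hence some finite union leaves less than [e]. *)
have [N /ltW hN] : exists N, (P ((\bigcup_n U n) `\` UC N) < e%:E)%E.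
  apply: nonincreasing_probability_lt.
  - by move=> n; exact: measurableD.
  - by move=> m n mn; apply/subsetPset; apply: setDS; exact: subset_bigsetU.
  - rewrite capUC; apply: le_lt_trans half _.
    by rewrite lte_fin ltr_pdivrMr// ltr_pMr// ltr1n.
exists (UC N), (\bigcup_n U n); split => //.
- by apply: closed_cylinder_bigsetU => n; have [] := CO n.
- by apply: open_cylinder_bigcup => n; have [] := CO n.
- move=> x UCx; have [n _ Cnx] := bigsetU_bigcup UCx; exists n => //.
  by have [_ _ CS _ _] := CO n; exact: CS.
- by apply: subset_bigcup => n _; have [] := CO n.
Qed.

Lemma regular_cylinder_sigma_algebra F :
  sigma_algebra setT [set S | regular_cylinder F S].
Proof.
split; last exact: regular_cylinder_bigcup.
- move=> e e0; exists set0, set0; split => //.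
  + by split; [exact: measurable0| |exact: closed0].
  + by split; [exact: measurable0| |exact: open0].
  + by rewrite setD0 measure0 lee_fin ltW.
- by move=> S rS; rewrite setTD; exact: regular_cylinderC.
Qed.

(** Regular events form a sigma-algebra, so open [B] suffice; in a metric space these are increasing
    unions of closed sets. *)
Lemma regular_cylinder_coordinate F i (B : set (borel_type E)) : F i ->
  measurable B -> regular_cylinder F (@coordinate J E i @^-1` B).
Proof.
move=> Fi; move: B; have [r0 rC rU] := regular_cylinder_sigma_algebra F.
apply: smallest_sub; first split.
- by rewrite /= preimage_set0.
- by move=> B rB; rewrite /= setTD preimage_setC -setTD; exact: rC.
- by move=> B rB; rewrite /= preimage_bigcup; exact: rU.
move=> U oO e e0; have [C [cC ndC CO]] := open_Fsigma oO.
have oOc : open_cylinder F (@coordinate J E i @^-1` U).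
  rewrite -(setCK U) preimage_setC; apply: closed_cylinderC.
  exact: (closed_cylinder_preimage Fi (open_closedC oO)).
have cCc n : closed_cylinder F (@coordinate J E i @^-1` C n).
  exact: (closed_cylinder_preimage Fi (cC n)).
have [n /ltW Pn] : exists n, (P ((@coordinate J E i @^-1` U) `\`
    (@coordinate J E i @^-1` C n)) < e%:E)%E.
  apply: nonincreasing_probability_lt.
  - by move=> n; apply: measurableD; [have [] := oOc|have [] := cCc n].
  - move=> m n mn; apply/subsetPset; apply: setDS; apply: preimage_subset.
    exact/subsetPset/ndC.
  - rewrite [X in P X](_ : _ = set0) ?measure0 ?lte_fin//.
    apply/seteqP; split => // x Hx; have [Ux _] := Hx 0%N I.
    move: Ux; rewrite -CO => -[n _ Cn]; have [_] := Hx n I; exact.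
exists (@coordinate J E i @^-1` C n), (@coordinate J E i @^-1` U); split => //.
by rewrite -CO => x Cx; exists n.
Qed.

Lemma measurable_regular_cylinder F (S : set Omega) :
  measurable S -> depends_on F S -> regular_cylinder F S.
Proof.
move=> mS dS; have := depends_on_sigma_of mS dS; move: S {mS dS}.
apply: (smallest_sub (regular_cylinder_sigma_algebra F)).
move=> _ [i Fi [B mB <-]]; rewrite /= setTI.
exact: regular_cylinder_coordinate.
Qed.

End cylinder_regularity.

(** * The algebra of cylinders *)

Section cylinder_algebra.
Context {J : Type} {d : measure_display} {E : measurableType d}.

Definition cylinder_display : measure_display. Proof. by constructor. Qed.

(** A second name for the function space, which carries the algebra of cylinders where [power_type]
    carries the generated sigma-field. *)
Definition cylinder_type := J -> E.

Definition cylinder (S : set (power_type J E)) : Prop :=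
  measurable S /\ exists F : set J, finite_set F /\ depends_on F S.

HB.instance Definition _ := Pointed.on cylinder_type.

Let cylinder0 : cylinder set0.
Proof. by split => //; exists set0; split. Qed.

Let cylinderU : setU_closed cylinder.
Proof.
move=> S S' [mS [F [fF dF]]] [mS' [F' [fF' dF']]]; split; first exact: measurableU.
exists (F `|` F'); split; first by rewrite finite_setU.
move=> x y xy; rewrite /setU/= (dF x y) ?(dF' x y)// => i Fi; apply: xy.
  by right.
by left.
Qed.

Let cylinderC : setC_closed cylinder.
Proof.
move=> S [mS [F [fF dF]]]; split; first exact: measurableC.
by exists F; split => // x y xy; rewrite /setC/= (dF x y).
Qed.

HB.instance Definition _ := @isAlgebraOfSets.Build cylinder_display
  cylinder_type cylinder cylinder0 cylinderU cylinderC.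

Lemma sigma_cylinder : <<s cylinder >> = @measurable _ (power_type J E).
Proof.
apply/seteqP; split.
  by apply: smallest_sub; [exact: sigma_algebra_measurable|move=> S []].
apply: smallest_sub; first exact: smallest_sigma_algebra.
move=> _ [i _ [B mB <-]]; apply: sub_sigma_algebra; split.
  rewrite setTI -[X in measurable X]setTI; exact: measurable_coordinate.
exists [set i]; split => // x y xy.
by rewrite setTI /preimage/= /coordinate xy.
Qed.

End cylinder_algebra.
Arguments cylinder_type : clear implicits.
Arguments cylinder_type J {d} E.

Section compact_cover_of_cylinders.
Context {R : realType} {E : pmetricType R} {J : choiceType}.
Local Notation Omega := (power_type J (borel_type E)).

(** By Tychonoff the box is compact, hence so is its intersection with the closed set [C]; the
    finite unions of the [U n] are open and increase. *)
Lemma compact_cylinder_cover (F : set J) (C : set Omega) (G : nat -> set J)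
    (U : (set Omega)^nat) (K : J -> set E) :
  closed_cylinder F C -> (forall n, open_cylinder (G n) (U n)) ->
  (forall j, compact (K j)) ->
  C `&` [set x | forall j, K j (x j)] `<=` \bigcup_n U n ->
  exists N, C `&` [set x | forall j, K j (x j)] `<=` \bigcup_(n < N) U n.
Proof.
move=> [_ _ cC] oU cK CU.
have : @compact (prod_topology (fun=> E : topologicalType))
    (C `&` [set x | forall j, K j (x j)]).
  rewrite setIC; apply: compact_closedI => //.
  exact: (@tychonoff J (fun=> E : topologicalType) K cK).
move=> /compact_near_coveringP /(_ nat \oo (fun n x => (\bigcup_(k < n) U k) x) _).
case=> [x /CU[k _ Ukx]|N _ CN]; last by exists N; exact: CN (leqnn N).
exists (U k, [set n | (k < n)%N]) => /=.
  split; last by exists k.+1.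
  by apply: open_nbhs_nbhs; split => //; have [] := oU k.
by move=> [y n] /= [Uky kn]; exists k.
Qed.

End compact_cover_of_cylinders.

(** * Countable subadditivity of the content on cylinders, and its extension *)

Section kolmogorov_extension.
Context {R : realType} {E : pmetricType R} {J : choiceType}.
Local Notation Omega := (power_type J (borel_type E)).
Variable mu : seq J -> probability Omega R.
Hypothesis mu_consistent : forall (s t : seq J) (S : set Omega),
  {subset s <= t} -> measurable S -> depends_on [set` s] S -> mu s S = mu t S.

(** The chosen list is immaterial, two lists being both contained in their concatenation. The
    default [0] is never reached on a cylinder. *)
Definition cylinder_content (S : set (cylinder_type J (borel_type E))) : \bar R :=
  if pselect (exists s : seq J, depends_on [set` s] S) is left e
  then mu (projT1 (cid e)) S else 0%E.

Lemma cylinder_contentE s (S : set Omega) :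
  measurable S -> depends_on [set` s] S -> cylinder_content S = mu s S.
Proof.
move=> mS dS; rewrite /cylinder_content; case: pselect => [e|]; last first.
  by move=> /forallNP /(_ s).
case: cid => t /= dt; rewrite (mu_consistent (t := s ++ t))//; last first.
  by move=> j; rewrite mem_cat => ->; rewrite orbT.
by rewrite [RHS](mu_consistent (t := s ++ t))// => j; rewrite mem_cat => ->.
Qed.

Lemma cylinderP (S : set (cylinder_type J (borel_type E))) : measurable S ->
  @measurable _ Omega S /\ exists s : seq J, depends_on [set` s] S.
Proof.
move=> [mS [F [/finite_seqP[s ->] dS]]]; split => //.
by exists s.
Qed.

Let content_ge0 S : (0 <= cylinder_content S)%E.
Proof. by rewrite /cylinder_content; case: pselect => // e; exact: measure_ge0. Qed.

Lemma depends_on_seqS (s t : seq J) (S : set Omega) :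
  {subset s <= t} -> depends_on [set` s] S -> depends_on [set` t] S.
Proof. by move=> st; apply: depends_onS => j; exact: st. Qed.

Let content_additive : measure_function.semi_additive cylinder_content.
Proof.
move=> F n mF tF mUF.
have /choice[s sP] : forall k, exists s : seq J, depends_on [set` s] (F k).
  by move=> k; have [] := cylinderP (mF k).
have mF' k : @measurable _ Omega (F k) by have [] := cylinderP (mF k).
have [mU [u dU]] := cylinderP mUF.
pose t := u ++ flatten [seq s k | k <- iota 0 n].
have st k : (k < n)%N -> {subset s k <= t}.
  move=> kn j sj; rewrite mem_cat; apply/orP; right.
  by apply/flattenP; exists (s k) => //; apply: map_f; rewrite mem_iota.
rewrite (@cylinder_contentE t)//; last first.
  by apply: depends_on_seqS dU => j uj; rewrite mem_cat uj.
rewrite (@measure_semi_additive _ _ _ (mu t) F n mF' tF mU).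
apply: eq_bigr => k _; rewrite (@cylinder_contentE t)//.
by apply: depends_on_seqS (sP k); exact: st.
Qed.

HB.instance Definition _ := isContent.Build cylinder_display
  (cylinder_type J (borel_type E)) R cylinder_content content_ge0 content_additive.

Variable L : (set E)^nat.
Hypotheses (L_compact : forall n, compact (L n)) (L_closed : forall n, closed (L n))
  (L_point : forall n, L n point) (L_nd : nondecreasing_seq L)
  (L_cover : \bigcup_n L n = setT).

Lemma coordinate_tight (P : probability Omega R) (j : J) (e : R) : 0 < e ->
  exists n, (P (@coordinate J E j @^-1` ~` L n) <= e%:E)%E.
Proof.
move=> e0; have [n /ltW Pn] : exists n, (P (@coordinate J E j @^-1` ~` L n) < e%:E)%E.
  apply: nonincreasing_probability_lt.
  - move=> n; rewrite preimage_setC; apply: (@measurableC _ Omega).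
    have jT : [set: J] j by [].
    by have [] := closed_cylinder_preimage jT (@L_closed n).
  - move=> m n mn; apply/subsetPset; apply: preimage_subset; apply: subsetC.
    exact/subsetPset/L_nd.
  - rewrite [X in P X](_ : _ = set0) ?measure0 ?lte_fin//.
    apply/seteqP; split => // x Hx.
    have : (\bigcup_n L n) (x j) by rewrite L_cover.
    by move=> [n _ Ln]; exact: (Hx n).
by exists n.
Qed.

Let content_sigma_subadditive : measurable_subset_sigma_subadditive cylinder_content.
Proof.
move=> S F mF mS SF.
have [mS' [s dS]] := cylinderP mS.
have mF' k : @measurable _ Omega (F k) by have [] := cylinderP (mF k).
have /choice[f fP] : forall k, exists s : seq J, depends_on [set` s] (F k).
  by move=> k; have [] := cylinderP (mF k).
(* Three losses of [dl] each: shrinking [S] to a closed set, enlarging all [F n] to open sets, and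
   leaving a compact box. *)
apply/lee_addgt0Pr => e e0; pose dl := e / 3.
have dl0 : 0 < dl by rewrite divr_gt0.
have dlp n : 0 < dl / (2 ^ n.+1)%:R by rewrite divr_gt0// ltr0n expn_gt0.
have [C [V [cC [mV _ _] CS SV PC]]] :
    exists C U, [/\ closed_cylinder [set` s] C, open_cylinder [set` s] U,
    C `<=` S, S `<=` U & (mu s (U `\` C) <= dl%:E)%E].
  exact: measurable_regular_cylinder.
have mC : @measurable _ Omega C by have [] := cC.
have {}PC : (mu s (S `\` C) <= dl%:E)%E.
  apply: le_trans PC; apply: le_measure; rewrite ?inE.
  - exact: (@measurableD _ Omega).
  - exact: (@measurableD _ Omega).
  - exact: setSD.
have /choice[U UP] : forall n, exists U, [/\ open_cylinder [set` f n] U,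
    F n `<=` U & (mu (f n) (U `\` F n) <= (dl / (2 ^ n.+1)%:R)%:E)%E].
  move=> n.
  have [C' [U [[mC' _ _] oU CF FU PU]]] :=
    measurable_regular_cylinder (mu (f n)) (mF' n) (fP n) (dlp n).
  exists U; split => //; apply: le_trans PU; apply: le_measure; rewrite ?inE.
  - by apply: measurableD => //; have [] := oU.
  - by apply: measurableD => //; have [] := oU.
  - exact: setDS.
(* The box is fixed before the finite subcover is known, so it has to control every coordinate used
   by [S] or by some [F n]. These are countably many, and an injective code [c] on them spreads the
   loss over a geometric series. *)
pose G := \bigcup_n [set` if n is k.+1 then f k else s].
have /countable_injP[c cI] : countable G.
  by apply: bigcup_countable => // n _; exact/finite_set_countable/finite_seq.
have /choice[m mP] : forall j, exists n,
    (mu [:: j] (@coordinate J E j @^-1` ~` L n) <= (dl / (2 ^ (c j).+1)%:R)%:E)%E.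
  by move=> j; exact: coordinate_tight.
have mU n : @measurable _ Omega (U n) by have [[]] := UP n.
have oU n : open_cylinder [set` f n] (U n) by have [] := UP n.
have [|N CN] := compact_cylinder_cover cC oU (fun j => @L_compact (m j)).
  by move=> x [/CS/SF[n _ Fx] _]; exists n => //; have [_ FU _] := UP n; exact: FU.
pose t := s ++ flatten [seq f n | n <- iota 0 N].
have st : {subset s <= t} by move=> j sj; rewrite mem_cat sj.
have ft k : (k < N)%N -> {subset f k <= t}.
  move=> kn j sj; rewrite mem_cat; apply/orP; right.
  by apply/flattenP; exists (f k) => //; apply: map_f; rewrite mem_iota.
have tG j : j \in t -> G j.
  rewrite mem_cat => /orP[sj|/flattenP[_ /mapP[n _ ->] fj]]; first by exists 0%N.
  by exists n.+1.
pose M := (\max_(j <- t) c j).+1.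
(* The bad events are indexed by codes: by injectivity at most one listed coordinate has code [k],
   so the bound on [B k] is a term of the geometric series. *)
pose B k := [set x : Omega | exists j, [/\ j \in t, c j = k & ~ L (m j) (x j)]].
have Bsmall k : @measurable _ Omega (B k) /\
    (mu t (B k) <= (dl / (2 ^ k.+1)%:R)%:E)%E.
  have [[j [jt <-]]|nB] := pselect (exists j, j \in t /\ c j = k); last first.
    rewrite (_ : B k = set0) ?measure0 ?lee_fin ?ltW//.
    by apply/seteqP; split => // x [j [jt ck _]]; apply: nB; exists j.
  have -> : B (c j) = @coordinate J E j @^-1` ~` L (m j).
    apply/seteqP; split => [x [j' [jt' cj' Lx]]|x Lx]; last by exists j.
    suff <- : j' = j by [].
    by apply: cI => //; rewrite inE; exact: tG.
  have [mL dL _] : closed_cylinder [set` [:: j]] (@coordinate J E j @^-1` L (m j)).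
    by apply: closed_cylinder_preimage => //=; rewrite inE.
  have mL' : @measurable _ Omega (@coordinate J E j @^-1` ~` L (m j)).
    by rewrite preimage_setC; exact: (@measurableC _ Omega).
  split => //; rewrite -(mu_consistent (s := [:: j]))//.
    by move=> i; rewrite inE => /eqP ->.
  by move=> x y xy; rewrite /preimage/= /coordinate xy//= inE.
have cover : S `<=` (S `\` C) `|`
    (\big[setU/set0]_(n < N) U n `|` \big[setU/set0]_(k < M) B k).
  move=> x Sx; have [Cx|nCx] := pselect (C x); last by left.
  right; have [Kx|] := pselect (forall j, j \in t -> L (m j) (x j)).
    left; rewrite -bigcup_mkord.
    (* The cover is known on the full box, while [x] is controlled on [t] only. Freezing sends the
       other coordinates to the base point, which every [L n] contains, and neither [C] nor [U n]
       with [n < N] notices. *)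
    have [|n nN Uy] := CN (freeze [set` t] x).
      split.
        have [_ dC _] := cC.
        rewrite (dC _ x)// => j sj; rewrite freezeE//; exact: st.
      move=> j /=; have [jt|jt] := pselect ([set` t] j).
        by rewrite freezeE//; exact: Kx.
      by rewrite freeze_out.
    exists n => //; have [[_ dU _] _ _] := UP n.
    rewrite (dU _ (freeze [set` t] x))// => j fj; rewrite freezeE//.
    exact: ft nN _ fj.
  move=> /existsNP[j /not_implyP[jt Lx]]; right; rewrite -bigcup_mkord.
  exists (c j); last by exists j.
  by rewrite /= /M ltnS; exact: leq_bigmax_seq.
rewrite (@cylinder_contentE t)//; last exact: depends_on_seqS dS.
have mUN : @measurable _ Omega (\big[setU/set0]_(n < N) U n).
  exact: (@bigsetU_measurable _ Omega).
have mBM : @measurable _ Omega (\big[setU/set0]_(k < M) B k).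
  by apply: (@bigsetU_measurable _ Omega) => k _; have [] := Bsmall k.
have mSC : @measurable _ Omega (S `\` C) by exact: (@measurableD _ Omega).
have dC : depends_on [set` s] (S `\` C).
  have [_ dC _] := cC.
  by move=> x y xy; rewrite /setD/= (dC x y)// (dS x y).
apply: (@le_trans _ _ (mu t (S `\` C) + (mu t (\big[setU/set0]_(n < N) U n) +
    mu t (\big[setU/set0]_(k < M) B k)))%E).
  apply: (@le_trans _ _ (mu t ((S `\` C) `|`
    (\big[setU/set0]_(n < N) U n `|` \big[setU/set0]_(k < M) B k)))).
    apply: le_measure => //; rewrite inE//.
    by apply: (@measurableU _ Omega) => //; exact: (@measurableU _ Omega).
  apply: le_trans (measureU2 (mu t) mSC (@measurableU _ Omega _ _ mUN mBM)) _.
  by rewrite leeD2l//; exact: measureU2.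
have boundU : (mu t (\big[setU/set0]_(n < N) U n) <=
    \sum_(n <oo) cylinder_content (F n) + dl%:E)%E.
  apply: (@le_trans _ _ (\sum_(n < N)
    (cylinder_content (F n) + (dl / (2 ^ n.+1)%:R)%:E))%E).
    apply: (le_trans (Boole_inequality _ _)) => //.
    apply: lee_sum => n _; have [[_ dU _] FU PU] := UP n.
    rewrite (@cylinder_contentE (f n))//.
    rewrite [leLHS](_ : _ = mu (f n) (U n)); last first.
      exact/esym/(mu_consistent (ft _ (ltn_ord n)) (mU n) dU).
    apply: le_trans (leeD (lexx _) PU).
    rewrite -measureU//; [|exact: (@measurableD _ Omega)|by rewrite setDIK].
    by rewrite setDUK.
  apply: le_trans (epsilon_trick _ _ _) => //; last exact: ltW.
  rewrite -(big_mkord xpredT (fun n => cylinder_content (F n) + (dl / (2 ^ n.+1)%:R)%:E))%E.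
  by apply: nneseries_lim_ge => n _ _; rewrite adde_ge0// lee_fin ltW.
have boundB : (mu t (\big[setU/set0]_(k < M) B k) <= dl%:E)%E.
  apply: (@le_trans _ _ (\sum_(k < M) (dl / (2 ^ k.+1)%:R)%:E)%E).
    apply: (le_trans (Boole_inequality _ _)).
      by move=> k _; have [] := Bsmall k.
    by apply: lee_sum => k _; have [] := Bsmall k.
  apply: le_trans (epsilon_trick0 xpredT (ltW dl0)).
  rewrite -(big_mkord xpredT (fun n => (dl / (2 ^ n.+1)%:R)%:E)).
  by apply: nneseries_lim_ge => n _ _; rewrite lee_fin ltW.
rewrite -(mu_consistent st mSC dC).
apply: (le_trans (leeD PC (leeD boundU boundB))).
rewrite addeCA -!addeA leeD2l// -!EFinD lee_fin /dl.
by lra.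
Qed.

HB.instance Definition _ := Content_SigmaSubAdditive_isMeasure.Build
  cylinder_display R (cylinder_type J (borel_type E)) cylinder_content
  content_sigma_subadditive.

Lemma kolmogorov_extension_subproof : exists P : probability Omega R,
  forall (s : seq J) (S : set Omega), measurable S -> depends_on [set` s] S -> P S = mu s S.
Proof.
pose m := measure_extension cylinder_content.
pose D := g_sigma_algebraType (@measurable _ (cylinder_type J (borel_type E))).
have mE (s : seq J) (S : set Omega) :
    measurable S -> depends_on [set` s] S -> m S = mu s S.
  move=> mS dS; rewrite /m /measure_extension.
  rewrite measurable_mu_extE/= ?(cylinder_contentE (s := s))//.
  by split => //; exists [set` s]; split => //; exact: finite_seq.
have mT : m setT = 1%E by rewrite (mE [::])// probability_setT.
pose P : probability D R := HB.pack (measure_extension cylinder_content)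
  (Measure_isProbability.Build _ _ _ m mT).
(* [D] and [Omega] have the same sigma-field, generated by cylinders and by coordinates
   respectively; the identity transports the measure. *)
have mid : measurable_fun [set: D] (id : D -> Omega).
  by move=> _ S mS; rewrite setTI preimage_id; rewrite -sigma_cylinder in mS.
exists (image_probability P mid) => s S mS dS.
exact: mE.
Qed.

End kolmogorov_extension.

Theorem kolmogorov_extension (R : realType) (E : pmetricType R) (J : choiceType)
    (mu : seq J -> probability (power_type J (borel_type E)) R) :
  locally_compact [set: E] -> separable_space E ->
  (forall (s t : seq J) (S : set (power_type J (borel_type E))),
    {subset s <= t} -> measurable S -> depends_on [set` s] S ->
    mu s S = mu t S) ->
  exists P : probability (power_type J (borel_type E)) R,
    forall (s : seq J) (S : set (power_type J (borel_type E))),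
      measurable S -> depends_on [set` s] S -> P S = mu s S.
Proof.
move=> lcE sepE mu_consistent.
have [L [cL clL Lpt ndL Lcover]] :=
  locally_compact_separable_sigma_compact lcE sepE.
exact: (@kolmogorov_extension_subproof _ _ _ mu mu_consistent L).
Qed.

(** * Increments spanned by finite lists *)

Lemma in_cons2 (X : eqType) (a b x : X) (s : seq X) :
  (x \in [:: a, b & s]) = (x == b) || (x \in a :: s).
Proof. by rewrite !in_cons orbCA. Qed.

Lemma seq_extremal (X : eqType) (le : X -> X -> Prop) :
  (forall x, le x x) ->
  (forall y x z, le x y -> le y z -> le x z) ->
  (forall x y, le x y -> le y x -> x = y) ->
  forall (s : seq X) (x : X), exists m, [/\ m \in x :: s, le x m &
    forall y, y \in x :: s -> le m y -> y = m].
Proof.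
move=> refl trans anti; elim=> [x|z s IH x].
  by exists x; split => //; [rewrite inE|move=> y; rewrite inE => /eqP].
have [m [ms xm maxm]] := IH x.
have [mz|mz] := pselect (le m z).
  exists z; split; [by rewrite in_cons2 eqxx|exact: trans xm mz|].
  move=> y; rewrite in_cons2 => /predU1P[-> //|ys] zy.
  have ym := maxm y ys (trans _ _ _ mz zy).
  by rewrite ym in zy *; exact: anti.
exists m; split => //; first by rewrite in_cons2 ms orbT.
by move=> y; rewrite in_cons2 => /predU1P[-> //|ys]; exact: maxm.
Qed.

Section indexing_meets.
Context {T : topologicalType} {A : indexing_collection T}.
Implicit Types (U V W : A) (s L : seq A).
Local Notation bot := (Defs.bottom A).

Lemma bottom_sub U : \val bot `<=` \val U.
Proof. by move=> x; apply; exact: set_mem (valP U). Qed.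

Lemma sub_antisym U V : \val U `<=` \val V -> \val V `<=` \val U -> U = V.
Proof. by move=> UV VU; apply: val_inj; apply/seteqP. Qed.

Lemma meet_subproof U V : \val U `&` \val V \in (A : set (set T)).
Proof.
apply/mem_set; rewrite -(bigcap2E (\val U) (\val V)).
have -> : \bigcap_i bigcap2 (\val U) (\val V) i =
    \bigcap_(B in [set \val U; \val V]) B.
  rewrite bigcap2E; apply/seteqP; split => [x [Ux Vx] B [->|->]//|x H].
  by split; apply: H; [left|right].
apply: icoll_bigcap; last by exists (\val U); left.
by move=> B [->|->]; [exact: set_mem (valP U)|exact: set_mem (valP V)].
Qed.

Definition meet U V : A := exist _ (\val U `&` \val V) (meet_subproof U V).

Lemma meetC : commutative meet.
Proof. by move=> U V; apply: val_inj; rewrite /= setIC. Qed.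

Lemma meetA : associative meet.
Proof. by move=> U V W; apply: val_inj; rewrite /= setIA. Qed.

Lemma meetxx : idempotent_op meet.
Proof. by move=> U; apply: val_inj; rewrite /= setIid. Qed.

Lemma meet_idPl U V : \val U `<=` \val V <-> meet U V = U.
Proof.
split=> [UV|<-]; first by apply: val_inj; rewrite /=; exact: setIidl.
exact: subIsetr.
Qed.

Lemma maximal_above s U : exists M, [/\ M \in U :: s, \val U `<=` \val M &
  forall V, V \in U :: s -> \val M `<=` \val V -> V = M].
Proof.
have [M [Ms UM maxM]] := seq_extremal (fun V => @subset_refl _ (\val V))
  (fun V2 V1 V3 => @subset_trans _ (\val V2) (\val V1) (\val V3)) sub_antisym s U.
by exists M.
Qed.

Lemma minimal_below s U : exists M, [/\ M \in U :: s, \val M `<=` \val U &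
  forall V, V \in U :: s -> \val V `<=` \val M -> V = M].
Proof.
have [M [Ms UM minM]] := seq_extremal (le := fun V W => \val W `<=` \val V)
  (fun V => @subset_refl _ (\val V))
  (fun V2 V1 V3 h1 h2 => @subset_trans _ (\val V2) (\val V3) (\val V1) h2 h1)
  (fun V W h1 h2 => sub_antisym h2 h1) s U.
by exists M.
Qed.

Lemma seq_shape U s : \val U `<=` \bigcup_(V in [set` s]) \val V ->
  exists2 V, V \in s & \val U `<=` \val V.
Proof.
move=> Us; have [_ [V /= Vs <-] UV] : exists2 B, [set \val V | V in [set` s]] B & \val U `<=` B.
  apply: icoll_shape (set_mem (valP U)) _ _ _.
  - by move=> _ [V _ <-]; exact: set_mem (valP V).
  - by apply: finite_image; exact: finite_seq.
  - by rewrite bigcup_image.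
by exists V.
Qed.

Definition traces U s : seq A := [seq meet U V | V <- bot :: s].

Lemma traces_sub U s V : V \in traces U s -> \val V `<=` \val U.
Proof. by move=> /mapP[W _ ->]; exact: subIsetl. Qed.

Definition maximal_traces U s : set A :=
  [set M | M \in traces U s /\
    forall V, V \in traces U s -> \val M `<=` \val V -> V = M].

Lemma traces_maximal U s V : V \in traces U s ->
  exists2 M, maximal_traces U s M & \val V `<=` \val M.
Proof.
move=> Vs; have [M [MVs VM maxM]] := maximal_above (traces U s) V.
exists M => //; split; first by move: MVs; rewrite in_cons => /predU1P[->|].
by move=> W Ws; apply: maxM; rewrite in_cons Ws orbT.
Qed.

Lemma bottom_traces U s : bot \in traces U s.
Proof.
rewrite /traces /= in_cons; apply/orP; left; apply/eqP/esym.
by rewrite meetC; apply/meet_idPl; exact: bottom_sub.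
Qed.

Lemma maximal_traces_finite U s : finite_set (maximal_traces U s).
Proof.
by apply: (@sub_finite_set _ _ [set` traces U s]) => [M []|]; last exact: finite_seq.
Qed.

Lemma maximal_traces_neq0 U s : maximal_traces U s !=set0.
Proof. by have [M ? _] := traces_maximal (bottom_traces U s); exists M. Qed.

Lemma maximal_traces_antichain U s V W : maximal_traces U s V ->
  maximal_traces U s W -> \val V `<=` \val W -> V = W.
Proof. by move=> [_ maxV] [Ws _] VW; apply/esym/maxV. Qed.

Lemma maximal_traces_sub U s V : maximal_traces U s V -> \val V `<=` \val U.
Proof. by move=> [/traces_sub]. Qed.

(* The increment with outer set U from which all the sets in s are removed;
   removing the bottom as well does no harm and makes s = [::] legal. *)
Definition incr_of U s : increment A :=
  Increment (maximal_traces_finite U s) (maximal_traces_neq0 U s)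
    (@maximal_traces_antichain U s) (@maximal_traces_sub U s).

Lemma incr_of_set U s : incr_set (incr_of U s) =
  \val U `\` \bigcup_(V in [set` bot :: s]) \val V.
Proof.
apply/seteqP; split => x [Ux nx]; split => // -[V Vs Vx]; apply: nx.
  have [M maxM VM] : exists2 M, maximal_traces U s M &
    \val (meet U V) `<=` \val M by apply: traces_maximal; exact: map_f.
  by exists M => //; exact: VM.
have [/mapP[W Ws VW] _] := Vs; exists W => //.
by move: Vx; rewrite VW => -[].
Qed.

(** The head is the set added last, and the bottom set is implicit. The last clause does double
    duty: it keeps every suffix closed under intersections, and, as [U] is not listed before, it
    prevents [U] from being included in an earlier set. *)
Fixpoint admissible s : Prop := if s is U :: s' then
  [/\ admissible s', U \notin bot :: s' &
    forall V, V \in s' -> meet U V \in bot :: s'] else True.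

Definition meet_closed L : Prop :=
  forall U V, U \in bot :: L -> V \in bot :: L ->
    meet U V \in bot :: L.

Lemma meet_bottom U : meet U bot = bot.
Proof. by rewrite meetC; apply/meet_idPl; exact: bottom_sub. Qed.

Lemma admissible_meet s : admissible s -> meet_closed s.
Proof.
elim: s => [_ U V|U s IH [/IH{}IH _ Us] V W].
  by rewrite !mem_seq1 => /eqP -> /eqP ->; rewrite meetxx.
have in3 Z : Z \in [:: bot, U & s] -> Z = U \/ Z \in bot :: s.
  by rewrite !inE => /or3P[->|/eqP ->|->]; rewrite ?orbT; [right|left|right].
have in3' Z : Z \in bot :: s -> Z \in [:: bot, U & s].
  by rewrite !inE => /orP[->|->]; rewrite ?orbT.
have Us' Z : Z \in bot :: s -> meet U Z \in bot :: s.
  by rewrite in_cons => /predU1P[->|/Us//]; rewrite meet_bottom mem_head.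
move=> /in3[->|Vs] /in3[->|Ws].
- by rewrite meetxx !inE eqxx orbT.
- exact/in3'/Us'.
- by rewrite meetC; exact/in3'/Us'.
- exact/in3'/IH.
Qed.

Lemma meet_closed_bigcap L (G : set A) U : meet_closed L ->
  finite_set G -> G !=set0 -> G `<=` [set` bot :: L] ->
  \val U = \bigcap_(V in G) \val V -> U \in bot :: L.
Proof.
move=> cL fG [V0 GV0] GL UE.
have [s sE] : exists s : seq A, G = [set` s] by exact/finite_seqP.
suff : forall r : seq A, {subset r <= s} -> exists2 W, W \in bot :: L &
    \val W = \val V0 `&` \bigcap_(V in [set` r]) \val V.
  move=> /(_ s (fun=> id)) [W WL WE]; suff -> : U = W by [].
  apply: val_inj; rewrite UE WE -sE; apply/seteqP; split => [x Gx|x []//].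
  by split => //; exact: Gx.
elim=> [_|V r IH rs].
  exists V0; first exact: GL.
  by apply/seteqP; split => [x V0x|x []//]; split => // V; rewrite /= in_nil.
have [|W WL WE] := IH; first by move=> Z Zr; apply: rs; rewrite in_cons Zr orbT.
exists (meet V W).
  by apply: cL => //; apply: GL; rewrite sE /=; apply: rs; rewrite mem_head.
rewrite /= WE; apply/seteqP; split => [x [Vx [V0x H]]|x [V0x H]]; split => //.
  by move=> Z /=; rewrite in_cons => /predU1P[->//|]; exact: H.
  by apply: H; rewrite /= mem_head.
by split => // Z /= Zr; apply: H; rewrite /= in_cons Zr orbT.
Qed.

Lemma admissible_traces U s V : admissible (U :: s) -> V \in bot :: s ->
  meet U V \in bot :: s.
Proof.
move=> [_ _ Us]; rewrite in_cons => /predU1P[->|/Us//].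
by rewrite meet_bottom mem_head.
Qed.

Lemma incr_of_neq0 U s : admissible (U :: s) -> incr_set (incr_of U s) <> set0.
Proof.
move=> adm; rewrite incr_of_set setD_eq0 => /seq_shape[V Vs /meet_idPl UV].
have [_ /negP + _] := adm; apply.
by rewrite -UV; exact: admissible_traces.
Qed.

(** Members of A_C are intersections of maximal traces, and these are listed. The clause of
    [incr_index] for empty increments would bring in [U] itself, but by Shape the increment is not
    empty. *)
Lemma incr_of_index U s : admissible (U :: s) ->
  incr_index (incr_of U s) `<=` [set` bot :: s].
Proof.
move=> adm V [[[G [Gmax G0 VE]] _]|[]]; last by move/(incr_of_neq0 adm).
apply: (meet_closed_bigcap _ _ G0 _ VE).
- by apply: admissible_meet; have [] := adm.
- by apply: sub_finite_set Gmax _; exact: maximal_traces_finite.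
- by move=> W /Gmax[/mapP[Z Zs ->] _]; exact: admissible_traces.
Qed.

Lemma incr_of_eq U s s' :
  (forall V, V \in s -> exists2 W, W \in bot :: s' & \val (meet U V) `<=` \val W) ->
  (forall V, V \in s' -> exists2 W, W \in bot :: s & \val (meet U V) `<=` \val W) ->
  incr_set (incr_of U s) = incr_set (incr_of U s').
Proof.
move=> ss' s's; rewrite !incr_of_set.
apply/seteqP; split => x [Ux nx]; split => // -[V /= Vs Vx]; apply: nx.
  move: Vs; rewrite in_cons => /predU1P[VE|/s's[W Ws VW]].
    by rewrite VE in Vx; exists bot => //; rewrite /= mem_head.
  by exists W => //; exact: VW.
move: Vs; rewrite in_cons => /predU1P[VE|/ss'[W Ws VW]].
  by rewrite VE in Vx; exists bot => //; rewrite /= mem_head.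
by exists W => //; exact: VW.
Qed.

Lemma admissible_uniq s : admissible s -> uniq (bot :: s).
Proof.
elim: s => // U s IH [/IH + Us _]; rewrite /= => /andP[bs ->].
by move: Us; rewrite !in_cons negb_or eq_sym (negbTE bs) => /andP[/negbTE -> ->].
Qed.

Lemma admissible_tail U s : admissible (U :: s) -> admissible s.
Proof. by case. Qed.

Lemma admissible_notin U s : admissible (U :: s) -> U \notin s.
Proof. by move=> /admissible_uniq /and3P[]. Qed.

Lemma admissible_size s t : admissible s -> admissible t -> s =i t ->
  size s = size t.
Proof.
move=> /admissible_uniq /andP[_ us] /admissible_uniq /andP[_ ut] st.
exact/perm_size/uniq_perm.
Qed.

Lemma admissible_bot s : admissible s -> bot \notin s.
Proof. by move=> /admissible_uniq /andP[]. Qed.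

(** Adding a minimal element of the rest of [L] keeps the list downward closed in [L], so the meets
    of the new element with the old ones are already listed. Prescribing the start [a] lets the
    removal argument decide which sets come first. *)
Lemma admissible_extend L a : meet_closed L -> bot \notin L ->
  admissible a -> {subset a <= L} ->
  (forall U V, U \in L -> V \in a -> \val U `<=` \val V -> U \in a) ->
  exists b, admissible (b ++ a) /\ b ++ a =i L.
Proof.
move=> cL bL; move En : (size L - size a)%N => n.
elim: n => [|n IH] in a En *; move=> adm aL down.
  have /andP[_ ua] := admissible_uniq adm.
  exists [::]; split => //= x; apply/idP/idP; first exact: aL.
  apply: contraTT => xa; apply/negP => xL.
  have : (size (x :: a) <= size L)%N.
    apply: uniq_leq_size; first by rewrite /= xa.
    by move=> y; rewrite in_cons => /predU1P[->|/aL].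
  by rewrite /= -subn_gt0 En.
have [/allP La|] := boolP (all [in a] L).
  exists [::]; split => //= x; apply/idP/idP; [exact: aL|exact: La].
rewrite -has_predC => /hasP[U0 U0L /= U0a].
have [W [Wl _ minW]] := minimal_below [seq U <- L | U \notin a] U0.
have inl V : V \in U0 :: [seq U <- L | U \notin a] = (V \in L) && (V \notin a).
  rewrite in_cons mem_filter andbC; case: eqP => //= ->.
  by rewrite U0L U0a.
have /andP[WL Wa] : (W \in L) && (W \notin a) by rewrite -inl.
have admW : admissible (W :: a).
  split => //; first rewrite in_cons negb_or Wa andbT.
    by apply: contraNneq bL => <-.
  move=> V Va; have := cL W V; rewrite !in_cons WL (aL V Va) !orbT => /(_ isT isT).
  move=> /predU1P[->|mL]; first by rewrite eqxx.
  by rewrite (down _ V)// ?orbT//; exact: subIsetr.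
have [|||b [admb bE]] := IH (W :: a) _ admW.
- by rewrite /= subnS En.
- by move=> V; rewrite in_cons => /predU1P[->|/aL].
- move=> U V UL; rewrite !in_cons => /predU1P[->|Va] UV; last first.
    by rewrite (down U V)// orbT.
  have [Ua|Ua] := boolP (U \in a); first by rewrite orbT.
  by rewrite (minW U) ?eqxx//; rewrite inl UL.
by exists (rcons b W); rewrite cat_rcons.
Qed.

Lemma admissible_exists L : meet_closed L -> bot \notin L ->
  exists s, admissible s /\ s =i L.
Proof.
move=> cL bL; have [|//|b] := admissible_extend (a := [::]) cL bL I; first by [].
by rewrite cats0 => -[? ?]; exists b.
Qed.

Fixpoint meets s : seq A :=
  if s is U :: s' then U :: meets s' ++ [seq meet U V | V <- meets s'] else [::].

Lemma mem_meets s U : U \in s -> U \in meets s.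
Proof.
elim: s => //= V s IH; rewrite !in_cons mem_cat => /predU1P[->|/IH->]; last first.
  by rewrite orbT.
by rewrite eqxx.
Qed.

Lemma meets_ind s (Q : A -> Prop) : (forall U, U \in s -> Q U) ->
  (forall U V, Q U -> Q V -> Q (meet U V)) -> forall U, U \in meets s -> Q U.
Proof.
move=> Qs Qm; elim: s Qs => //= V s IH Qs.
have QV : Q V by apply: Qs; rewrite mem_head.
have {}IH U : U \in meets s -> Q U.
  by apply: IH => W Ws; apply: Qs; rewrite in_cons Ws orbT.
move=> U; rewrite in_cons mem_cat => /predU1P[->//|/orP[/IH//|/mapP[W Ws ->]]].
by apply: Qm => //; exact: IH.
Qed.

Lemma meets_meet s U V : U \in meets s -> V \in meets s -> meet U V \in meets s.
Proof.
elim: s U V => //= W s IH U V.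
have sub X : X \in meets s -> X \in W :: meets s ++ [seq meet W V | V <- meets s].
  by move=> Xs; rewrite in_cons mem_cat Xs orbT.
have subW X : X \in meets s -> meet W X \in W :: meets s ++ [seq meet W V | V <- meets s].
  by move=> Xs; rewrite in_cons mem_cat (map_f (meet W) Xs) !orbT.
rewrite [in X in X -> _]in_cons [in X in X -> _]mem_cat.
move=> /predU1P[->|/orP[Us|/mapP[U' Us ->]]];
  rewrite [in X in X -> _]in_cons [in X in X -> _]mem_cat;
  move=> /predU1P[->|/orP[Vs|/mapP[V' Vs ->]]].
- by rewrite meetxx mem_head.
- exact: subW.
- by rewrite meetA meetxx; exact: subW.
- by rewrite meetC; exact: subW.
- by apply: sub; exact: IH.
- by rewrite meetA (meetC U) -meetA; apply: subW; exact: IH.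
- by rewrite meetC meetA meetxx; exact: subW.
- by rewrite -meetA; apply: subW; exact: IH.
- rewrite -meetA (meetA U') (meetC U') -(meetA W) (meetA W W) meetxx.
  by apply: subW; exact: IH.
Qed.

Definition proper_meets s : seq A := [seq U <- meets s | U != bot].

Lemma bot_proper_meets s : bot \notin proper_meets s.
Proof. by rewrite mem_filter eqxx. Qed.

Lemma mem_proper_meets s U : U \in bot :: proper_meets s = (U == bot) || (U \in meets s).
Proof. by rewrite in_cons mem_filter; case: eqP. Qed.

Lemma meet_closed_meets s : meet_closed (proper_meets s).
Proof.
move=> U V; rewrite !mem_proper_meets => /predU1P[->|Us].
  by rewrite meetC meet_bottom eqxx.
move=> /predU1P[->|Vs]; first by rewrite meet_bottom eqxx.
by rewrite meets_meet ?orbT.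
Qed.

Lemma admissible_cover s : exists2 t, admissible t & {subset s <= bot :: t}.
Proof.
have [t [admt tE]] := admissible_exists (@meet_closed_meets s) (bot_proper_meets s).
exists t => // U Us; rewrite in_cons tE -in_cons mem_proper_meets.
by rewrite mem_meets ?orbT.
Qed.

End indexing_meets.

(** * Resampling one coordinate *)

Section kernel_precomposition.
Context {d1 d2 d3 : measure_display} {X : measurableType d1}
  {Y : measurableType d2} {Z : measurableType d3} {R : realType}.

Definition kernel_precomp (k : R.-pker Y ~> Z) (f : X -> Y)
    (mf : measurable_fun setT f) (x : X) : {measure set Z -> \bar R} := k (f x).

Section instances.
Variables (k : R.-pker Y ~> Z) (f : X -> Y) (mf : measurable_fun setT f).

Let kernel_precomp_measurable S :
  measurable S -> measurable_fun setT (kernel_precomp k mf ^~ S).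
Proof. by move=> mS; apply: measurableT_comp (measurable_kernel k S mS) mf. Qed.

HB.instance Definition _ := isKernel.Build _ _ _ _ _ (kernel_precomp k mf)
  kernel_precomp_measurable.

Let kernel_precomp_setT x : kernel_precomp k mf x setT = 1%E.
Proof. exact: prob_kernel. Qed.

HB.instance Definition _ := Kernel_isProbability.Build _ _ _ _ _
  (kernel_precomp k mf) kernel_precomp_setT.

End instances.

Definition kernel_cst (P : probability Y R) (_ : X) :
  {measure set Y -> \bar R} := P.

Section instances.
Variable P : probability Y R.

Let kernel_cst_measurable S :
  measurable S -> measurable_fun setT (kernel_cst P ^~ S).
Proof. by move=> mS; exact: measurable_cst. Qed.

HB.instance Definition _ := isKernel.Build _ _ _ _ _ (kernel_cst P)
  kernel_cst_measurable.

Let kernel_cst_setT x : kernel_cst P x setT = 1%E.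
Proof. exact: probability_setT. Qed.

HB.instance Definition _ := Kernel_isProbability.Build _ _ _ _ _
  (kernel_cst P) kernel_cst_setT.

End instances.

Definition kernel_probability (k : R.-pker X ~> Y) (x : X) : set Y -> \bar R := k x.

Section instances.
Variables (k : R.-pker X ~> Y) (x : X).

HB.instance Definition _ := isMeasure.Build _ _ _ (kernel_probability k x)
  (measure0 (k x)) (measure_ge0 (k x)) (@measure_semi_sigma_additive _ _ _ (k x)).

HB.instance Definition _ := Measure_isProbability.Build _ _ _
  (kernel_probability k x) (prob_kernel x).

End instances.
End kernel_precomposition.

Section resampling.
Context {R : realType} {T : topologicalType} {A : indexing_collection T}.
Context {d : measure_display} {E : measurableType d}.
Variables (p : transition_family A E R) (p_tsys : is_transition_system p).
Local Notation Omega := (power_type A E).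
Local Notation bot := (Defs.bottom A).
Implicit Types (U V W : A) (s : seq A) (c : increment A) (x : Omega).
Local Open Scope ereal_scope.

Lemma measurable_incr_restr c :
  measurable_fun [set: Omega] (incr_restr c : Omega -> _).
Proof.
apply: measurable_to_power => i; exact: (measurable_coordinate (\val i)).
Qed.

Lemma measurable_update d1 (X : measurableType d1) (f : X -> Omega) (g : X -> E) U :
  measurable_fun setT f -> measurable_fun setT g ->
  measurable_fun setT (fun z => update (f z) U (g z) : Omega).
Proof.
move=> mf mg; apply: measurable_to_power => V; rewrite /update.
case: asboolP => // _.
exact: (measurableT_comp (measurable_coordinate V) mf).
Qed.

Lemma measurable_update_pair U :
  measurable_fun [set: Omega * E] (fun z => update z.1 U z.2 : Omega).
Proof. by apply: measurable_update. Qed.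

Lemma measurable_update2 x U :
  measurable_fun [set: E] (fun y => update x U y : Omega).
Proof. by apply: measurable_update. Qed.

(** The Markov operator of one step: the coordinate [outer c] is redrawn given x_C. Comparing the
    laws of different lists amounts to identities between products of such operators. *)
Definition resample c (f : Omega -> \bar R) x : \bar R :=
  \int[p c (incr_restr c x)]_y f (update x (outer c) y).

Lemma resample_ge0 c f x : (forall x, 0 <= f x) -> 0 <= resample c f x.
Proof. by move=> f0; exact: integral_ge0. Qed.

Lemma measurable_resample c f : measurable_fun setT f -> (forall x, 0 <= f x) ->
  measurable_fun setT (resample c f).
Proof.
move=> mf f0.
have := measurable_fun_integral_sfinite_kernel
  (fun z : Omega * E => f (update z.1 (outer c) z.2))
  (kernel_precomp (p c) (@measurable_incr_restr c)) (fun z => f0 _).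
by apply; exact: (measurableT_comp mf (@measurable_update_pair (outer c))).
Qed.

Lemma update_same x U y : update x U y U = y.
Proof. by rewrite /update asboolT. Qed.

Lemma update_other x U V y : V <> U -> update x U y V = x V.
Proof. by move=> VU; rewrite /update asboolF. Qed.

Lemma updateC x U V y z : U <> V ->
  update (update x U y) V z = update (update x V z) U y.
Proof.
move=> UV; apply/funext => W; rewrite /update.
by case: asboolP => [->|//]; case: asboolP => [VU|//]; case: UV.
Qed.

Lemma incr_restr_eq c x x' : (forall U, incr_index c U -> x U = x' U) ->
  incr_restr c x = incr_restr c x'.
Proof. by move=> xx'; apply/funext => -[U cU]; exact: xx' (set_mem cU). Qed.

(* Chapman-Kolmogorov with A' the outer set, so that C'' is empty. *)
Lemma kernel_incr_eq c c' x S : outer c' = outer c -> incr_set c' = incr_set c ->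
  measurable S -> p c (incr_restr c x) S = p c' (incr_restr c' x) S.
Proof.
move=> oc ic mS.
(* The empty increment with the same outer set. Its kernel is a Dirac mass at the integration
   variable, so the integral returns the kernel of [c']. *)
pose c0 := incr_of (outer c) [:: outer c].
have c00 : incr_set c0 = set0.
  rewrite incr_of_set setD_eq0 => y Uy.
  by exists (outer c) => //=; rewrite !inE eqxx orbT.
rewrite (tsys_CK p_tsys (c1 := c') (c2 := c0) (A' := outer c)) //.
- rewrite (eq_integral (fun y => (\1_S y)%:E)).
    by rewrite integral_indic// setIT.
  move=> y _; rewrite (tsys_empty p_tsys)//= oc update_same//.
- by rewrite oc setIid.
- by rewrite ic; apply/esym/setIidl => y [].
- by rewrite c00; apply/esym/seteqP; split => // y [[]].
Qed.

Lemma resample_incr_eq c c' f x : outer c' = outer c -> incr_set c' = incr_set c ->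
  resample c f x = resample c' f x.
Proof.
move=> oc ic; rewrite /resample oc.
by apply: eq_measure_integral => S mS _; exact: kernel_incr_eq.
Qed.


Definition independent_of V (f : Omega -> \bar R) : Prop :=
  forall x y, f (update x V y) = f x.

Lemma depends_on_independent_of (F : set A) V f :
  depends_on F f -> ~ F V -> independent_of V f.
Proof.
by move=> dF nFV x y; apply: dF => U FU; rewrite update_other// => UV; rewrite UV in FU.
Qed.

Lemma update_incr_restr U V s x y : admissible (U :: s) -> V \notin bot :: s ->
  incr_restr (incr_of U s) (update x V y) = incr_restr (incr_of U s) x.
Proof.
move=> adm Vs; apply: incr_restr_eq => W /(incr_of_index adm) /= Ws.
by rewrite update_other// => WV; rewrite WV (negbTE Vs) in Ws.
Qed.

Lemma resample_depends_on U s f : admissible (U :: s) ->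
  depends_on [set` [:: bot, U & s]] f ->
  depends_on [set` bot :: s] (resample (incr_of U s) f).
Proof.
move=> adm df x x' xx'; rewrite /resample.
rewrite (@incr_restr_eq _ x x'); last by move=> V /(incr_of_index adm); exact: xx'.
apply: eq_integral => y _; apply: df => V /=.
rewrite /update; case: asboolP => // VU; rewrite !in_cons (introF eqP VU)/= -in_cons.
exact: xx'.
Qed.

Lemma resample_independent_of U V s f : admissible (U :: s) ->
  V \notin [:: bot, U & s] -> independent_of V f ->
  independent_of V (resample (incr_of U s) f).
Proof.
move=> adm Vn fV x y.
have Vs : V \notin bot :: s.
  by apply: contra Vn; rewrite !in_cons => /orP[->//|->]; rewrite !orbT.
have UV : V <> U by move=> VU; rewrite VU !in_cons eqxx orbT in Vn.
rewrite /resample update_incr_restr//.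
by apply: eq_integral => z _; rewrite /= updateC ?fV.
Qed.

Lemma fubini_kernel d1 d2 (X : measurableType d1) (Y : measurableType d2)
    (k1 : R.-pker X ~> E) (k2 : R.-pker Y ~> E) a b (f : E * E -> \bar R) :
  measurable_fun setT f -> (forall z, 0 <= f z) ->
  \int[k1 a]_y \int[k2 b]_z f (y, z) = \int[k2 b]_z \int[k1 a]_y f (y, z).
Proof.
move=> mf f0.
exact: (@fubini_tonelli _ _ _ _ _ (kernel_probability k1 a)
  (kernel_probability k2 b) f mf f0).
Qed.

(** Both increments remove the same list [s], so neither kernel reads the coordinate redrawn by the
    other; with both kernels fixed, this is Tonelli. *)
Lemma resampleC U V s f x : admissible (U :: s) -> admissible (V :: s) ->
  U <> V -> measurable_fun setT f -> (forall x, 0 <= f x) ->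
  resample (incr_of U s) (resample (incr_of V s) f) x =
  resample (incr_of V s) (resample (incr_of U s) f) x.
Proof.
move=> admU admV UV mf f0; rewrite /resample.
have [[_ Us _] [_ Vs _]] := (admU, admV).
under eq_integral do rewrite update_incr_restr//.
under [RHS]eq_integral do rewrite update_incr_restr//.
rewrite /= (fubini_kernel (p _) (p _) _ _
  (f := fun z : E * E => f (update (update x U z.1) V z.2)))//.
  by apply: eq_integral => z _; apply: eq_integral => y _; rewrite updateC.
apply: (measurableT_comp mf).
apply: (@measurable_update _ _ (fun z : E * E => update x U z.1 : Omega) snd) => //.
exact: (@measurable_update _ _ (fun=> x) fst).
Qed.

(** Chapman-Kolmogorov for the increment of [U] cut along [V]. As it speaks of sets, it is read as
    an equality of measures in the coordinate [U]; since [f] ignores [V], both sides integrate the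
    same function [h] of that coordinate. *)
Lemma resample_CK U V s f x : \val V `<=` \val U -> V <> U ->
  independent_of V f -> measurable_fun setT f -> (forall x, 0 <= f x) ->
  resample (incr_of V s) (resample (incr_of U (V :: s)) f) x =
  resample (incr_of U s) f x.
Proof.
move=> VU VnU fV mf f0.
have mr : measurable_fun [set: unit * E]
    (fun z => incr_restr (incr_of U (V :: s)) (update x V z.2 : Omega)).
  apply: (measurableT_comp (@measurable_incr_restr _)).
  by apply: (@measurable_update _ _ (fun=> x) snd).
(* With [x] fixed the source is the dummy type [unit], so that the integral formula for composed
   kernels applies. *)
pose l := kernel_precomp (p (incr_of V s))
  (@measurable_cst _ _ unit _ setT (incr_restr (incr_of V s) x)).
pose k := kernel_precomp (p (incr_of U (V :: s))) mr.
pose h z := f (update x U z).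
have mh : measurable_fun setT h by exact: (measurableT_comp mf (@measurable_update2 x U)).
transitivity (\int[p (incr_of V s) (incr_restr (incr_of V s) x)]_y
  \int[p (incr_of U (V :: s)) (incr_restr (incr_of U (V :: s)) (update x V y))]_z h z).
  rewrite /resample; apply: eq_integral => y _; apply: eq_integral => z _.
  by rewrite /= updateC// fV.
transitivity (\int[kcomp l k tt]_z h z).
  exact: (esym (integral_kcomp l k tt (fun z => f0 (update x U z)) mh)).
apply: eq_measure_integral => S mS _ /=.
rewrite (tsys_CK p_tsys (c1 := incr_of V s) (c2 := incr_of U (V :: s)) (A' := V))//.
- by rewrite /=; apply/esym/setIidr.
- rewrite !incr_of_set; apply/seteqP; split => [y [Vy ny]|y [[Uy ny] Vy]]; split => //.
  by split => //; exact: VU.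
- rewrite !incr_of_set; apply/seteqP; split => [y [Uy ny]|y [[Uy ny] Vy]]; split => //.
  + split => // -[W Ws Wy]; apply: ny; exists W => //.
    by rewrite /= in_cons2 -/([set` bot :: s] W) Ws orbT.
  + by move=> Vy; apply: ny; exists V => //; rewrite /= in_cons2 eqxx.
  + move=> [W /=]; rewrite in_cons2 => /predU1P[->//|Ws] Wy.
    by apply: ny; exists W.
Qed.

End resampling.

(** * Finite-dimensional laws *)

Section finite_dimensional_laws.
Context {R : realType} {T : topologicalType} {A : indexing_collection T}.
Context {d : measure_display} {E : measurableType d}.
Variables (p : transition_family A E R) (p_tsys : is_transition_system p).
Variable nu : probability E R.
Local Notation Omega := (power_type A E).
Local Notation bot := (Defs.bottom A).
Implicit Types (U V W : A) (s t a b : seq A) (c : increment A) (x : Omega).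
Implicit Types f : Omega -> \bar R.
Local Open Scope ereal_scope.

Definition nn_measurable f : Prop := measurable_fun setT f /\ forall x, 0 <= f x.

Lemma nn_measurable_resample c f : nn_measurable f -> nn_measurable (resample p c f).
Proof.
move=> [mf f0]; split; first exact: measurable_resample.
by move=> x; exact: resample_ge0.
Qed.

Lemma measurable_incr_restr_snd c : measurable_fun [set: unit * Omega]
  (fun z => incr_restr c z.2 : power_type (incr_index c) E).
Proof. exact: (measurableT_comp (@measurable_incr_restr _ _ _ _ c)). Qed.

Lemma measurable_update_snd c : measurable_fun [set: (unit * Omega) * E]
  (fun z => update z.1.2 (outer c) z.2 : Omega).
Proof.
apply: (@measurable_update _ _ _ _ _ _ (fun z : (unit * Omega) * E => z.1.2) snd) => //.
by apply: measurableT_comp.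
Qed.

(** The factor [unit] is there because composition hands the second kernel the source of the first
    along with its value. *)
Definition resample_kernel c : R.-sfker (unit * Omega) ~> Omega :=
  mkcomp (kernel_precomp (p c) (@measurable_incr_restr_snd c))
    (kdirac (@measurable_update_snd c)).

(* The list is read from right to left: the law of (bot, V_1, ..., V_n) is
   law [:: V_n; ...; V_1]; unlisted coordinates sit at the base point. *)
Fixpoint law s : R.-sfker unit ~> Omega :=
  if s is U :: s' then mkcomp (law s') (resample_kernel (incr_of U s'))
  else kernel_cst (image_probability nu
    (@measurable_update2 _ _ _ _ (point : Omega) bot)).

Definition expect s f := \int[law s tt]_x f x.

Lemma integral_resample_kernel c x f : nn_measurable f ->
  \int[resample_kernel c (tt, x)]_z f z = resample p c f x.
Proof.
move=> [mf f0]; rewrite [LHS]integral_kcomp//.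
apply: eq_integral => y _; rewrite integral_dirac// diracT mul1e//.
Qed.

Lemma expect_nil f : nn_measurable f ->
  expect [::] f = \int[nu]_y f (update (point : Omega) bot y).
Proof. by move=> [mf f0]; exact: integral_image_probability. Qed.

Lemma expect_cons U s f : nn_measurable f ->
  expect (U :: s) f = expect s (resample p (incr_of U s) f).
Proof.
move=> [mf f0]; rewrite /expect [LHS]integral_kcomp//.
by apply: eq_integral => x _; exact: integral_resample_kernel.
Qed.

Lemma resample_independent c f x : independent_of (outer c) f ->
  resample p c f x = f x.
Proof.
move=> fc; rewrite /resample (eq_integral (cst (f x))) => [|y _ /=]; last exact: fc.
by rewrite integral_cst// prob_kernel mule1.
Qed.

Lemma law_setT s : law s tt setT = 1.
Proof.
suff : expect s (cst 1) = 1 by rewrite /expect integral_cst//= mul1e.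
elim: s => [|U s IH].
  by rewrite expect_nil//= integral_cst//= probability_setT mul1e.
rewrite expect_cons// -[RHS]IH; congr (expect s _).
by apply/funext => x; exact: resample_independent.
Qed.

Definition law_probability s : set Omega -> \bar R := law s tt.

HB.instance Definition _ s := isMeasure.Build _ _ _ (law_probability s)
  (measure0 (law s tt)) (measure_ge0 (law s tt))
  (@measure_semi_sigma_additive _ _ _ (law s tt)).

HB.instance Definition _ s := Measure_isProbability.Build _ _ _
  (law_probability s) (law_setT s).

Lemma eq_resample_incr_of U s s' f :
  (forall V, V \in s -> exists2 W, W \in bot :: s' & \val (meet U V) `<=` \val W) ->
  (forall V, V \in s' -> exists2 W, W \in bot :: s & \val (meet U V) `<=` \val W) ->
  resample p (incr_of U s) f = resample p (incr_of U s') f.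
Proof.
move=> ss' s's; apply/funext => x; apply: (resample_incr_eq p_tsys) => //.
exact: incr_of_eq.
Qed.

Lemma eq_mem_resample U s s' f : s =i s' ->
  resample p (incr_of U s) f = resample p (incr_of U s') f.
Proof.
move=> ss'; apply: eq_resample_incr_of => V Vs; exists V; rewrite /=.
- by rewrite in_cons -ss' Vs orbT.
- exact: subIsetr.
- by rewrite in_cons ss' Vs orbT.
- exact: subIsetr.
Qed.

(* Two admissible orders of the same semilattice end in two maximal elements,
   which can be resampled in either order by Fubini. *)
Lemma expect_reorder s t f : admissible s -> admissible t -> s =i t ->
  nn_measurable f -> expect s f = expect t f.
Proof.
move En : (size s) => n; elim: n => [|n IH] in s t En f *.
  move: s En => [|//] _ _; case: t => [//|V t] _ /(_ V).
  by rewrite mem_head in_nil.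
case: s En => [//|M s] [sn] adms; case: t => [|M' t] admt st nf.
  by have := st M; rewrite mem_head in_nil.
have [adms' admt'] := (admissible_tail adms, admissible_tail admt).
have [Ms M't] := (admissible_notin adms, admissible_notin admt).
rewrite !expect_cons//.
have [MM'|MM'] := eqVneq M M'.
  rewrite -MM' in st M't *.
  have st' : s =i t.
    move=> V; have := st V; rewrite !in_cons; case: eqVneq => //= -> _.
    by rewrite (negbTE Ms) (negbTE M't).
  by rewrite (eq_mem_resample M f st'); apply: IH => //; exact: nn_measurable_resample.
have M's : M' \in s.
  by have := st M'; rewrite mem_head in_cons eq_sym (negbTE MM').
have Mt : M \in t by have := st M; rewrite mem_head in_cons (negbTE MM').
(* The sets other than [M] and [M']. They are closed under intersections because both tails are, so
   the tails can be reordered as [M' :: r] and [M :: r]. *)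
pose l := [seq V <- s | V \in t].
have lE V : V \in bot :: l = (V \in bot :: s) && (V \in bot :: t).
  by rewrite !in_cons mem_filter; case: eqP => //= _; rewrite andbC.
have cl : meet_closed l.
  move=> V W; rewrite !lE => /andP[Vs Vt] /andP[Ws Wt].
  by apply/andP; split; exact: admissible_meet.
have bl : bot \notin l by rewrite mem_filter negb_and (admissible_bot adms') orbT.
have [r [admr rl]] := admissible_exists cl bl.
have rE V : V \in bot :: r = (V \in bot :: s) && (V \in bot :: t).
  by rewrite -lE !in_cons rl.
have rst V : V \in r -> (V \in s) /\ (V \in t).
  by rewrite rl mem_filter => /andP[].
have meetr : meet M M' \in bot :: r.
  rewrite rE; apply/andP; split.
    by apply: (admissible_traces adms); rewrite in_cons M's orbT.
  by rewrite meetC; apply: (admissible_traces admt); rewrite in_cons Mt orbT.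
have admM'r : admissible (M' :: r).
  split=> //; first by rewrite rE negb_and (let: And3 _ h _ := admt in h) orbT.
  move=> V /rst[Vs Vt]; rewrite rE; apply/andP; split; last first.
    by apply: (admissible_traces admt); rewrite in_cons Vt orbT.
  by apply: admissible_meet; rewrite // in_cons ?M's ?Vs orbT.
have admMr : admissible (M :: r).
  split=> //; first by rewrite rE negb_and (let: And3 _ h _ := adms in h).
  move=> V /rst[Vs Vt]; rewrite rE; apply/andP; split.
    by apply: (admissible_traces adms); rewrite in_cons Vs orbT.
  by apply: admissible_meet; rewrite // in_cons ?Mt ?Vt orbT.
have M'r : M' :: r =i s.
  move=> V; rewrite in_cons rl mem_filter; case: eqVneq => [->//|VM' /=].
  rewrite andbC; case Vs : (V \in s) => //=.
  by have := st V; rewrite !in_cons Vs orbT (negbTE VM').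
have Mr : M :: r =i t.
  move=> V; rewrite in_cons rl mem_filter; case: eqVneq => [->//|VM /=].
  case Vt : (V \in t) => //=.
  by have := st V; rewrite !in_cons Vt orbT (negbTE VM).
(* When the meet of [V] and [W] is already removed, removing [W] too leaves the increment of [V]
   unchanged. Thus [M] and [M'] contribute increments over the same [r], as the exchange by Fubini
   demands. *)
have drop_trace V W f' : meet V W \in bot :: r ->
    resample p (incr_of V (W :: r)) f' = resample p (incr_of V r) f'.
  move=> VWr; apply: eq_resample_incr_of => Z.
    rewrite in_cons => /predU1P[->|Zr]; first by exists (meet V W).
    by exists Z; [rewrite in_cons Zr orbT|exact: subIsetr].
  by move=> Zr; exists Z; [rewrite !in_cons Zr !orbT|exact: subIsetr].
have sizer : size (M' :: r) = n by rewrite (admissible_size admM'r adms' M'r).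
have sizer' : size (M :: r) = n by rewrite -sizer.
have nr c := nn_measurable_resample c nf.
have -> : expect s (resample p (incr_of M s) f) =
    expect r (resample p (incr_of M' r) (resample p (incr_of M r) f)).
  rewrite -(eq_mem_resample M f M'r) drop_trace//.
  by rewrite -(IH (M' :: r) s sizer _ admM'r adms' M'r (nr _)) expect_cons.
have -> : expect t (resample p (incr_of M' t) f) =
    expect r (resample p (incr_of M r) (resample p (incr_of M' r) f)).
  rewrite -(eq_mem_resample M' f Mr) drop_trace; last by rewrite meetC.
  by rewrite -(IH (M :: r) t sizer' _ admMr admt' Mr (nr _)) expect_cons.
congr (expect r _); apply/funext => x; case: nf => mf f0.
by apply: resampleC => //; exact/nesym/eqP.
Qed.

Fixpoint resamples b a f : Omega -> \bar R :=
  if b is U :: b' then resamples b' a (resample p (incr_of U (b' ++ a)) f) else f.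

Lemma nn_measurable_resamples b a f : nn_measurable f ->
  nn_measurable (resamples b a f).
Proof.
by elim: b f => //= U b IH f nf; apply: IH; exact: nn_measurable_resample.
Qed.

Lemma expect_cat b a f : nn_measurable f ->
  expect (b ++ a) f = expect a (resamples b a f).
Proof.
elim: b f => //= U b IH f nf; rewrite expect_cons// IH//.
exact: nn_measurable_resample.
Qed.

Lemma resamples_independent_of b a W f : admissible (b ++ a) ->
  W \notin bot :: b ++ a -> independent_of W f ->
  independent_of W (resamples b a f).
Proof.
elim: b f => //= U b IH f adm; rewrite in_cons2 negb_or => /andP[WU Wba] fW.
apply: IH => //; first by case: adm.
by apply: resample_independent_of => //; rewrite in_cons2 negb_or WU.
Qed.

Lemma resamples_cons2 b a V W f : \val W `<=` \val V ->
  resamples b [:: V, W & a] f = resamples b (V :: a) f.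
Proof.
move=> WV; elim: b f => [//|U b IH f].
have memE Z : (Z \in b ++ [:: V, W & a]) = (Z == W) || (Z \in b ++ V :: a).
  by rewrite !mem_cat in_cons2 orbCA.
rewrite -[LHS]/(resamples b [:: V, W & a] (resample p (incr_of U (b ++ [:: V, W & a])) f)).
rewrite -[RHS]/(resamples b (V :: a) (resample p (incr_of U (b ++ V :: a)) f)).
rewrite IH (@eq_resample_incr_of U (b ++ [:: V, W & a]) (b ++ V :: a) f)// => Z.
  rewrite memE => /predU1P[->|Zb].
    exists V; first by rewrite in_cons mem_cat mem_head !orbT.
    by apply: subset_trans WV; exact: subIsetr.
  by exists Z; [rewrite in_cons Zb orbT|exact: subIsetr].
by move=> Zb; exists Z; [rewrite in_cons memE Zb !orbT|exact: subIsetr].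
Qed.

(* V is the least element of t containing W: listing W just before V, the
   Chapman-Kolmogorov equation integrates W out, and the elements listed after
   V do not see W. *)
Lemma expect_remove_below s t W V f : admissible s -> admissible t ->
  W \in s -> (forall U, U \in t = (U \in s) && (U != W)) ->
  V \in t -> \val W `<=` \val V ->
  (forall U, U \in t -> \val W `<=` \val U -> \val V `<=` \val U) ->
  independent_of W f -> nn_measurable f -> expect s f = expect t f.
Proof.
move=> adms admt Ws tE Vt WV minV fW nf.
have ts U : U \in t -> U \in s by rewrite tE => /andP[].
have Wt : W \notin t by rewrite tE eqxx andbF.
have WnV : W <> V by move=> WeV; rewrite WeV Vt in Wt.
have Wb : W \notin bot :: t.
  by rewrite in_cons negb_or Wt andbT; apply: contraNneq (admissible_bot adms) => <-.
(* The sets strictly below [V] are listed first. Followed by [V] they are downward closed in [t],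
   hence extend to an admissible order of [t], into which [W] is then inserted just before [V]. *)
pose l := [seq U <- t | `[< \val U `<=` \val V >] && (U != V)].
have lE U : U \in l <-> [/\ U \in t, \val U `<=` \val V & U <> V].
  rewrite mem_filter; split=> [/andP[/andP[/asboolP UV /eqP UnV] Ut]//|[Ut UV UnV]].
  by rewrite Ut andbT; apply/andP; split; [exact/asboolP|exact/eqP].
have down Z U : U \in bot :: t -> Z \in l -> \val U `<=` \val Z -> U \in bot :: l.
  rewrite !in_cons => /predU1P[->|Ut]; first by rewrite eqxx.
  move=> /lE[Zt ZV ZnV] UZ; apply/orP; right; apply/lE; split => //.
    exact: subset_trans ZV.
  by move=> UeV; apply: ZnV; apply: sub_antisym => //; rewrite -UeV.
have bl : bot \notin l by apply: contra (admissible_bot admt) => /lE[].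
have cl : meet_closed l.
  move=> U Z; rewrite in_cons => /predU1P[->|Ul].
    by rewrite meetC meet_bottom mem_head.
  rewrite in_cons => /predU1P[->|Zl]; first by rewrite meet_bottom mem_head.
  apply: (down U) => //; last exact: subIsetl.
  have [/lE[Ut _ _] /lE[Zt _ _]] := (Ul, Zl).
  by apply: admissible_meet; rewrite // in_cons ?Ut ?Zt orbT.
have [a [adma al]] := admissible_exists cl bl.
have bal : bot :: a =i bot :: l by move=> U; rewrite !in_cons al.
have at_ U : U \in a -> U \in t by rewrite al => /lE[].
have meetWa U : U \in bot :: t -> meet U W \in [:: W, bot & a].
  rewrite in_cons => /predU1P[->|/ts Us].
    by rewrite meetC meet_bottom in_cons2 eqxx.
  have : meet U W \in bot :: s by apply: admissible_meet; rewrite // in_cons ?Us ?Ws orbT.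
  rewrite in_cons => /predU1P[->|ms]; first by rewrite !in_cons eqxx orbT.
  rewrite in_cons; case: eqVneq => //= mW; rewrite in_cons al; apply/orP; right.
  apply/lE; split; first by rewrite tE ms.
    by apply: subset_trans WV; exact: subIsetr.
  by move=> mV; apply: WnV; apply: sub_antisym => //; rewrite -mV; exact: subIsetr.
(* A set of [a] containing [W] would contain [V] by [minV], yet it lies strictly below [V]; so [W]
   is included in no earlier set. *)
have admWa : admissible (W :: a).
  split=> //; first by apply: contra Wb; rewrite !in_cons => /orP[->//|/at_ ->]; rewrite orbT.
  move=> U Ua; have Ut := at_ U Ua.
  have := meetWa U; rewrite in_cons Ut orbT meetC => /(_ isT).
  rewrite in_cons => /predU1P[/meet_idPl WU|//].
  by move: Ua; rewrite al => /lE[_ UV []]; apply: sub_antisym => //; exact: minV.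
have Va : V \notin bot :: a.
  rewrite bal in_cons negb_or; apply/andP; split.
    by apply: contraNneq (admissible_bot admt) => <-.
  by apply/negP => /lE[].
have meetVa U : U \in a -> meet V U = U.
  by rewrite al => /lE[_ UV _]; rewrite meetC; exact/meet_idPl.
have admVa : admissible (V :: a).
  by split=> // U Ua; rewrite meetVa// in_cons Ua orbT.
have [b [admb bE]] : exists b, admissible (b ++ V :: a) /\ b ++ V :: a =i t.
  apply: admissible_extend => //; [exact: admissible_meet|exact: admissible_bot| |].
    by move=> U; rewrite in_cons => /predU1P[->//|/at_].
  move=> U Z Ut; rewrite !in_cons => /predU1P[->|Za] UZ.
    case: eqVneq => //= /eqP UnV; rewrite al; exact/lE.
  have := down Z U; rewrite -al -bal !in_cons Ut orbT => /(_ isT Za UZ).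
  move=> /predU1P[Ub|->]; last by rewrite orbT.
  by move: (admissible_bot admt); rewrite -Ub Ut.
have bVE b' : b' ++ [:: V, W & a] =i W :: (b' ++ V :: a).
  by move=> U; rewrite in_cons !mem_cat in_cons2 orbCA.
have bVE2 b' : bot :: (b' ++ [:: V, W & a]) =i [:: W, bot & (b' ++ V :: a)].
  by move=> U; rewrite in_cons bVE in_cons in_cons2 -in_cons.
have admbW : admissible (b ++ [:: V, W & a]).
  have : {subset b <= t} by move=> U Ub; rewrite -bE mem_cat Ub.
  elim: b admb {bE} => [_ _|U b IH /= [admb Ub cU] bt].
    split=> //.
      by rewrite in_cons2 negb_or Va andbT; apply/eqP/nesym.
    move=> U; rewrite in_cons => /predU1P[->|Ua].
      by rewrite meetC (meet_idPl _ _).1// !in_cons eqxx orbT.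
    by rewrite meetVa// !in_cons Ua !orbT.
  have Ut : U \in t by apply: bt; rewrite mem_head.
  split.
  - by apply: IH => // Z Zb; apply: bt; rewrite in_cons Zb orbT.
  - rewrite bVE2 in_cons negb_or Ub andbT.
    by apply: contraNneq Wt => <-.
  - move=> Z; rewrite bVE in_cons bVE2 in_cons => /predU1P[->|/cU ->]; last first.
      by rewrite orbT.
    have := meetWa U; rewrite in_cons Ut orbT in_cons => /(_ isT) /orP[->//|].
    rewrite !in_cons mem_cat in_cons => /orP[->|->]; by rewrite !orbT.
have bWE : s =i b ++ [:: V, W & a].
  by move=> U; rewrite bVE in_cons bE tE; case: eqVneq => [->|]; rewrite ?andbT.
rewrite (expect_reorder adms admbW bWE)// -(expect_reorder admb admt bE)//.
rewrite (expect_cat b [:: V, W & a] nf) (expect_cat b (V :: a) nf).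
rewrite (resamples_cons2 b a f WV).
set g := resamples b (V :: a) f.
have ng : nn_measurable g by exact: nn_measurable_resamples.
have gW : independent_of W g.
  by apply: resamples_independent_of => //; rewrite in_cons bE -in_cons.
rewrite (expect_cons V (W :: a) ng) (expect_cons V a ng).
rewrite (expect_cons W a (nn_measurable_resample _ ng)).
congr (expect a _); apply/funext => x; case: ng => mg g0.
exact: resample_CK.
Qed.

(** A minimal set of [t] containing [W] is least: its meet with another one contains [W], hence is
    not the bottom set and is again in [t]. If no set of [t] contains [W], then [W] can be listed
    last, and redrawing it leaves [f] unchanged. *)
Lemma expect_remove s t W f : admissible s -> admissible t ->
  W \in s -> (forall U, U \in t = (U \in s) && (U != W)) ->
  independent_of W f -> nn_measurable f -> expect s f = expect t f.
Proof.
move=> adms admt Ws tE fW nf.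
have ts U : U \in t -> U \in s by rewrite tE => /andP[].
have Wb : W \notin bot :: t.
  rewrite in_cons negb_or tE eqxx andbF andbT.
  by apply: contraNneq (admissible_bot adms) => <-.
have [[V0 [V0t WV0]]|noV] := pselect (exists V, V \in t /\ \val W `<=` \val V).
  pose l := [seq U <- t | `[< \val W `<=` \val U >]].
  have lE U : U \in V0 :: l <-> U \in t /\ \val W `<=` \val U.
    rewrite in_cons mem_filter; split=> [/predU1P[->//|/andP[/asboolP]]//|[-> WU]].
    by rewrite andbT; apply/orP; right; exact/asboolP.
  have [V [/lE[Vt WV] _ minV]] := minimal_below l V0.
  apply: (@expect_remove_below s t W V) => // U Ut WU.
  apply/meet_idPl; apply: minV; last exact: subIsetl.
  have Wm : \val W `<=` \val (meet V U) by move=> y Wy; split; [exact: WV|exact: WU].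
  apply/lE; split => //.
  have : meet V U \in bot :: t by apply: admissible_meet; rewrite // in_cons ?Vt ?Ut orbT.
  rewrite in_cons => /predU1P[mb|//].
  have Wbot : W = bot by apply: sub_antisym; [rewrite -mb|exact: bottom_sub].
  by move: Wb; rewrite Wbot mem_head.
have admWt : admissible (W :: t).
  split=> // U Ut.
  have : meet W U \in bot :: s.
    by apply: admissible_meet; rewrite // in_cons ?Ws ?(ts U Ut) orbT.
  rewrite !in_cons tE => /orP[->//|->]; apply/orP; right.
  by apply/eqP => /meet_idPl WU; apply: noV; exists U.
rewrite (expect_reorder adms admWt)//.
  rewrite expect_cons//; congr (expect t _); apply/funext => x.
  exact: resample_independent.
by move=> U; rewrite in_cons tE; case: eqVneq => [->|]; rewrite ?andbT.
Qed.

(** Dropping a set may destroy closure under intersections, so a maximal [W] among the sets outside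
    [t] goes first. Were it the intersection of two other sets, both would contain it strictly,
    hence belong to [bot :: t] by maximality, and so would [W]. *)
Lemma expect_consistent s t f : admissible s -> admissible t -> {subset t <= s} ->
  depends_on [set` bot :: t] f -> nn_measurable f -> expect s f = expect t f.
Proof.
move En : (size s) => n; elim: n => [|n IH] in s En *; move=> adms admt ts df nf.
  apply: expect_reorder => // V; apply/idP/idP; last exact: ts.
  by move: En => /size0nil ->.
have [/allP st|] := boolP (all [in t] s).
  apply: expect_reorder => // V; apply/idP/idP; [exact: st|exact: ts].
rewrite -has_predC => /hasP[W0 W0s /= W0t].
pose l := [seq U <- s | U \notin t].
have lE U : U \in W0 :: l = (U \in s) && (U \notin t).
  by rewrite in_cons mem_filter andbC; case: eqP => //= ->; rewrite W0s W0t.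
have [W [+ _ maxW]] := maximal_above l W0; rewrite lE => /andP[Ws Wt].
have Wbot : W != bot by apply: contraNneq (admissible_bot adms) => <-.
pose s1 := [seq U <- s | U != W].
have s1E U : U \in bot :: s1 = (U \in bot :: s) && (U != W).
  rewrite !in_cons mem_filter; case: eqVneq => [->|] /=; first by rewrite eq_sym.
  by rewrite andbC.
have cs1 : meet_closed s1.
  move=> U V; rewrite !s1E => /andP[Us UW] /andP[Vs VW].
  apply/andP; split; first exact: admissible_meet.
  apply/negP => /eqP UVW.
  have above Z : Z \in bot :: s -> Z != W -> \val W `<=` \val Z -> Z \in bot :: t.
    rewrite !in_cons => /predU1P[->|Zs] ZW WZ; first by rewrite eqxx.
    have [Zt|Zt] := boolP (Z \in t); first by rewrite orbT.
    by move: ZW; rewrite (maxW Z) ?eqxx// lE Zs.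
  have : W \in bot :: t.
    rewrite -UVW; apply: admissible_meet => //; apply: above => //; rewrite -UVW.
      exact: subIsetl.
    exact: subIsetr.
  by rewrite in_cons (negbTE Wbot) (negbTE Wt).
have bs1 : bot \notin s1 by rewrite mem_filter (negbTE (admissible_bot adms)) andbF.
have [r [admr rs1]] := admissible_exists cs1 bs1.
have rE U : U \in r = (U \in s) && (U != W) by rewrite rs1 mem_filter andbC.
rewrite (@expect_remove s r W)//; last first.
  apply: depends_on_independent_of df _ => /=.
  by rewrite in_cons (negbTE Wbot) (negbTE Wt).
apply: IH => //.
  apply/eq_add_S; rewrite -En; apply: (perm_size (s1 := W :: r)).
  have [/andP[_ ur] /andP[_ us]] := (admissible_uniq admr, admissible_uniq adms).
  apply: uniq_perm => //; first by rewrite cons_uniq rE eqxx andbF.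
  by move=> U; rewrite in_cons rE; case: eqVneq => [->|]; rewrite ?andbT.
by move=> U Ut; rewrite rE (ts U Ut); apply: contraNneq Wt => <-.
Qed.

End finite_dimensional_laws.

(** * The Markov property *)

Section markov_property.
Context {R : realType} {T : topologicalType} {A : indexing_collection T}.
Context {d : measure_display} {E : measurableType d}.
Variables (p : transition_family A E R) (p_tsys : is_transition_system p).
Variable nu : probability E R.
Local Notation Omega := (power_type A E).
Local Notation bot := (Defs.bottom A).
Implicit Types (U V W : A) (s t : seq A) (c : increment A) (x : Omega).
Local Open Scope ereal_scope.

Definition misses c V : Prop := \val V `&` incr_set c = set0.

Definition kernel_mean c (g : E -> \bar R) x : \bar R :=
  \int[p c (incr_restr c x)]_y g y.

Lemma kernel_mean_ge0 c (g : E -> \bar R) x : (forall y, 0 <= g y) ->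
  0 <= kernel_mean c g x.
Proof. by move=> g0; exact: integral_ge0. Qed.

Lemma measurable_kernel_mean c (g : E -> \bar R) :
  measurable_fun setT g -> (forall y, 0 <= g y) ->
  measurable_fun setT (kernel_mean c g).
Proof.
move=> mg g0.
apply: (@measurable_fun_integral_kernel _ _ _ _ _
  (kernel_precomp (p c) (@measurable_incr_restr _ _ _ _ c))) => // S mS.
exact: measurable_kernel.
Qed.

Lemma kernel_mean_depends_on c g : depends_on (incr_index c) (kernel_mean c g).
Proof. by move=> x x' xx'; rewrite /kernel_mean (incr_restr_eq xx'). Qed.

Lemma kernel_mean_incr_eq c c' g x : outer c' = outer c ->
  incr_set c' = incr_set c -> kernel_mean c g x = kernel_mean c' g x.
Proof.
move=> oc ic; apply: eq_measure_integral => S mS _.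
exact: (kernel_incr_eq p_tsys).
Qed.

Lemma kernel_mean_empty c g x : incr_set c = set0 -> measurable_fun setT g ->
  kernel_mean c g x = g (x (outer c)).
Proof.
move=> c0 mg; rewrite /kernel_mean (eq_measure_integral (\d_(x (outer c)))).
  by rewrite integral_dirac// diracT mul1e.
by move=> S mS _; exact: (tsys_empty p_tsys).
Qed.

Lemma restrict_ge0 (f : Omega -> \bar R) D x : (forall x, 0 <= f x) -> 0 <= (f \_ D) x.
Proof. by move=> f0; rewrite patchE; case: ifPn. Qed.

Lemma restrict_measurable (f : Omega -> \bar R) (D : set Omega) : measurable D ->
  measurable_fun setT f -> measurable_fun setT (f \_ D).
Proof.
by move=> mD mf; apply/(measurable_restrictT _ mD); exact: measurable_funTS.
Qed.

Lemma restrict_depends_on (F : set A) (f : Omega -> \bar R) (D : set Omega) :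
  depends_on F f -> depends_on F D -> depends_on F (f \_ D).
Proof.
move=> df dD x x' xx'; by rewrite !patchE (df x x')// (depends_on_mem dD xx').
Qed.

Lemma resample_restrict c (g : E -> \bar R) (D : set Omega) (F : set A) x :
  depends_on F D -> ~ F (outer c) ->
  resample p c ((fun w => g (w (outer c))) \_ D) x = (kernel_mean c g \_ D) x.
Proof.
move=> dD cF; rewrite patchE /resample.
have upd y : (update x (outer c) y \in D) = (x \in D).
  apply: (depends_on_mem dD) => V FV.
  by rewrite update_other// => VU; rewrite VU in FV.
case: ifPn => xD; last first.
  by rewrite integral0_eq// => y _; rewrite patchE upd (negbTE xD).
by apply: eq_integral => y _; rewrite patchE upd xD update_same.
Qed.

(** A member of A_C is an intersection of sets removed in [c], unless [c] is empty and everything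
    misses it. This is what makes X_C measurable for [Gstar]. *)
Lemma incr_index_misses c V : incr_index c V -> misses c V.
Proof.
move=> [[[G [Gc [V0 GV0] VE]] _]|[c0 _]]; last by rewrite /misses c0 setI0.
apply/seteqP; split => // x [Vx [_]]; apply; exists V0; first exact: Gc.
by move: Vx; rewrite VE; apply.
Qed.

Variable P : probability Omega R.
Hypothesis P_law : forall s, admissible s ->
  agree_on [set` bot :: s] P (law_probability p nu s).

Lemma expect_agree s f : admissible s -> depends_on [set` bot :: s] f ->
  nn_measurable f -> \int[P]_x f x = expect p nu s f.
Proof.
by move=> adms df [mf f0]; exact: (agree_on_integral (P_law adms)).
Qed.

(* The elements of the semilattice spanned by s, by the sets removed in c and
   by their traces on the outer set U all miss c; U is maximal once added, and
   the increment it then contributes is c. *)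
Lemma admissible_for_increment c s : incr_set c <> set0 ->
  (forall V, V \in s -> misses c V) ->
  exists t, [/\ admissible (outer c :: t), {subset s <= bot :: t} &
    incr_set (incr_of (outer c) t) = incr_set c].
Proof.
move=> cn0 sc; have /finite_seqP[e eE] := extremal_finite c.
set U := outer c.
have botc : misses c bot.
  have [V cV] := extremal_neq0 c.
  apply/seteqP; split => // x [bx [_]]; apply; exists V => //.
  exact: bottom_sub bx.
pose l := (s ++ e) ++ [seq meet U V | V <- s ++ e].
have lse V : V \in s ++ e -> misses c V.
  rewrite mem_cat => /orP[/sc//|Ve]; apply/seteqP; split => // x [Vx [_]]; apply.
  by exists V => //; rewrite eE.
have missm V W : misses c V -> misses c (meet V W).
  by move=> Vc; apply/seteqP; split => // x [[Vx _] cx]; rewrite -Vc.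
have lc V : V \in meets l -> misses c V.
  move: V; apply: meets_ind => [V|V W Vc _]; last exact: missm.
  rewrite mem_cat => /orP[/lse//|/mapP[W Ws ->]].
  by rewrite meetC; apply: missm; exact: lse.
have lU V : V \in meets l -> meet U V \in meets l.
  have : V \in meets l -> V \in meets l /\ meet U V \in meets l.
    move: V; apply: meets_ind => [V Vl|V W [Vl UVl] [Wl UWl]].
      split; first exact: mem_meets.
      move: Vl; rewrite mem_cat => /orP[Vs|/mapP[W Ws ->]].
        by apply: mem_meets; rewrite mem_cat (map_f (meet U) Vs) orbT.
      rewrite meetA meetxx.
      by apply: mem_meets; rewrite mem_cat (map_f (meet U) Ws) orbT.
    by split; [exact: meets_meet|rewrite meetA; exact: meets_meet].
  by move=> h /h[].
have [t [admt tE]] := admissible_exists (@meet_closed_meets _ _ l) (bot_proper_meets l).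
have btE V : V \in bot :: t = (V == bot) || (V \in meets l).
  by rewrite in_cons tE -in_cons mem_proper_meets.
have tc V : V \in bot :: t -> misses c V.
  by rewrite btE => /predU1P[->//|/lc].
exists t; split.
- split=> //.
    apply/negP => /tc Uc; apply: cn0; rewrite -Uc; apply/esym/setIidr.
    by move=> x [].
  move=> V Vt; rewrite btE lU ?orbT//.
  by move: Vt; rewrite tE mem_filter => /andP[].
- by move=> V Vs; rewrite btE mem_meets ?orbT// !mem_cat Vs.
- rewrite incr_of_set; apply/seteqP; split => x [Ux nx]; split => // -[V Vc Vx].
    apply: nx; exists V => //=; rewrite btE mem_meets ?orbT//.
    by move: Vc; rewrite eE /= => Ve; rewrite !mem_cat Ve orbT.
  by have : (\val V `&` incr_set c) x by []; rewrite (tc _ Vc).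
Qed.

(** [D] depends on sets listed before [outer c], so the last resampling acts on [g] alone and turns
    it into its kernel mean. Nonnegative [g] keeps the identity free of integrability questions. *)
Lemma cylinder_markov c s (D : set Omega) (g : E -> \bar R) :
  (forall V, V \in s -> misses c V) -> measurable D -> depends_on [set` s] D ->
  measurable_fun setT g -> (forall y, 0 <= g y) ->
  \int[P]_(x in D) g (x (outer c)) = \int[P]_(x in D) kernel_mean c g x.
Proof.
move=> sc mD dD mg g0.
(* Every set misses an empty increment, so [D] may depend on the outer coordinate itself; here the
   kernel is a Dirac mass and the integrands are equal. *)
have [c0|cn0] := pselect (incr_set c = set0).
  by apply: eq_integral => x _; rewrite kernel_mean_empty.
have [t [adm st ic]] := admissible_for_increment cn0 sc.
have dDt : depends_on [set` bot :: t] D by apply: depends_onS dD => V /st.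
have tU : ~ [set` bot :: t] (outer c) by case: adm => _ /negP.
rewrite integral_mkcond [RHS]integral_mkcond.
have nphi : nn_measurable ((fun x => g (x (outer c))) \_ D).
  split; last by move=> x; exact: restrict_ge0.
  by apply: restrict_measurable => //; exact: (measurableT_comp mg (measurable_coordinate _)).
have dphi : depends_on [set` [:: bot, outer c & t]] ((fun x => g (x (outer c))) \_ D).
  apply: restrict_depends_on; last first.
    by apply: depends_onS dDt => V /= Vt; rewrite in_cons2 Vt orbT.
  by move=> x x' xx'; rewrite xx'//= in_cons2 eqxx.
rewrite (expect_agree adm dphi nphi) (expect_cons p nu (outer c) t nphi).
rewrite -(expect_agree (admissible_tail adm)); last 2 first.
- exact: resample_depends_on.
- exact: nn_measurable_resample.
apply: eq_integral => x _.
rewrite (@resample_restrict (incr_of (outer c) t) g D [set` bot :: t])//.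
by rewrite !patchE (@kernel_mean_incr_eq c (incr_of (outer c) t)).
Qed.

End markov_property.

Section integral_lambda_system.
Context {d : measure_display} {S : measurableType d} {R : realType}.
Variable P : probability S R.
Local Open Scope ereal_scope.

(** Finiteness of the total integral allows the subtraction that gives stability under
    complements. *)
Lemma integral_eq_dynkin (f g : S -> \bar R) :
  measurable_fun setT f -> measurable_fun setT g ->
  (forall x, 0 <= f x) -> (forall x, 0 <= g x) ->
  \int[P]_x f x < +oo -> \int[P]_x f x = \int[P]_x g x ->
  dynkin [set D | measurable D /\ \int[P]_(x in D) f x = \int[P]_(x in D) g x].
Proof.
move=> mf mg f0 g0 foo fg; split.
- by split.
- move=> D [mD Dfg]; split; first exact: measurableC.
  have split_int (h : S -> \bar R) : measurable_fun setT h -> (forall x, 0 <= h x) ->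
      \int[P]_x h x = \int[P]_(x in D) h x + \int[P]_(x in ~` D) h x.
    move=> mh h0; rewrite -ge0_integral_setU ?setUv//; first exact: measurableC.
    by apply/disj_setPCl.
  have Dfin : \int[P]_(x in D) f x \is a fin_num.
    rewrite ge0_fin_numE; last exact: integral_ge0.
    by apply: le_lt_trans foo; exact: ge0_subset_integral.
  have := fg; rewrite (split_int f)// (split_int g)// -Dfg.
  move=> /(congr1 (fun z => z - \int[P]_(x in D) f x)).
  by rewrite ![_ + \int[_]_(_ in ~` _) _]addeC !addeK.
- move=> F tF mF; split; first by apply: bigcupT_measurable => n; have [] := mF n.
  rewrite !ge0_integral_bigcup//.
  + by apply: eq_eseriesr => n _; have [] := mF n.
  + by move=> n; have [] := mF n.
  + exact: measurable_funTS.
  + by move=> n; have [] := mF n.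
  + exact: measurable_funTS.
Qed.

End integral_lambda_system.

(** * The completed sigma-field attached to an increment *)

Section Gstar_theory.
Context {R : realType} {T : topologicalType} {A : indexing_collection T}.
Context {d : measure_display} {E : measurableType d}.
Local Notation Omega := (power_type A E).
Local Notation X := (@coordinate A E : A -> Omega -> E).
Implicit Types (U V W : A) (s t : seq A) (c : increment A) (D : set Omega).
Variable P : probability Omega R.
Local Notation F := (natural_filtration P X).
Local Open Scope ereal_scope.

Lemma Gstar_coordinate c V (B : set E) : misses c V -> measurable B ->
  Gstar F c (X V @^-1` B).
Proof.
move=> cV mB; apply: sub_sigma_algebra; exists (\val V).
  split=> //; exists [set \val V]; split => //.
  - by move=> _ ->; exact: set_mem (valP V).
  - by exists (\val V).
  - by rewrite bigcup_set1.
apply: sub_sigma_algebra; exists V => //.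
apply: sub_sigma_algebra; left; exists V => //; exists B => //.
by rewrite setTI.
Qed.

Lemma Gstar_cylinder c (G : set A) D : (forall V, G V -> misses c V) ->
  measurable D -> depends_on G D -> Gstar F c D.
Proof.
move=> Gc mD dD; have := depends_on_sigma_of mD dD; move: D {mD dD}.
apply: smallest_sub; first exact: smallest_sigma_algebra.
by move=> _ [V GV [B mB <-]]; rewrite setTI; apply: Gstar_coordinate => //; exact: Gc.
Qed.

(** An induction principle through three nested generated sigma-fields, down to the coordinates that
    miss [c] and the null events. *)
Lemma Gstar_subset c (H : set (set Omega)) : sigma_algebra setT H ->
  (forall V B, misses c V -> measurable B -> H (X V @^-1` B)) ->
  (forall N, measurable N -> P N = 0 -> H N) -> Gstar F c `<=` H.
Proof.
move=> sH HX HN; apply: smallest_sub => // S [B [_ Bc]].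
move: S; apply: smallest_sub => // S [V /= VB].
move: S; apply: smallest_sub => // S [[U /= UV [G mG <-]]|[mN N0]]; last exact: HN.
rewrite setTI; apply: HX => //; apply/seteqP; split => // x [Ux cx].
by rewrite -Bc; split => //; exact/VB/UV.
Qed.

Lemma Gstar_measurable c : Gstar F c `<=` measurable.
Proof.
apply: Gstar_subset => //; first exact: sigma_algebra_measurable.
move=> V B _ mB; rewrite -[X in measurable X]setTI.
exact: measurable_coordinate.
Qed.

(** Completion puts null events among the generators. Allowing equality almost everywhere absorbs
    them, a null event being almost a cylinder over the empty list, and leaves a class stable under
    intersection. *)
Definition almost_cylinder c D : Prop := measurable D /\
  exists s D', [/\ forall V, V \in s -> misses c V, measurable D',
    depends_on [set` s] D' & {ae P, forall x, D x = D' x}].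

Lemma almost_cylinderI c : setI_closed (almost_cylinder c).
Proof.
move=> D1 D2 [mD1 [s1 [D1' [sc1 mD1' dD1' e1]]]] [mD2 [s2 [D2' [sc2 mD2' dD2' e2]]]].
split; first exact: measurableI.
exists (s1 ++ s2), (D1' `&` D2'); split.
- by move=> V; rewrite mem_cat => /orP[/sc1|/sc2].
- exact: measurableI.
- move=> x y xy; rewrite /setI/= (dD1' x y) ?(dD2' x y)// => V Vs; apply: xy => /=.
    by rewrite mem_cat [V \in s2]Vs orbT.
  by rewrite mem_cat [V \in s1]Vs.
- by apply: filterS2 e1 e2 => x /= e1 e2; rewrite /setI/= e1 e2.
Qed.

Lemma Gstar_almost_cylinder c : Gstar F c `<=` <<s almost_cylinder c >>.
Proof.
apply: Gstar_subset; first exact: smallest_sigma_algebra.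
- move=> V B cV mB; apply: sub_sigma_algebra.
  have mVB : measurable (X V @^-1` B : set Omega).
    by rewrite -[X in measurable X]setTI; exact: measurable_coordinate.
  split=> //; exists [:: V], (X V @^-1` B); split => //.
  + by move=> U; rewrite mem_seq1 => /eqP ->.
  + by move=> x y xy; rewrite /preimage/= /coordinate xy//= mem_seq1.
  + by near=> x.
- move=> N mN N0; apply: sub_sigma_algebra; split=> //.
  exists [::], set0; split => //; exists N; split => // x /= Nx.
  by apply: contrapT => nNx; apply: Nx; apply/propext; split.
Unshelve. all: by end_near. Qed.

Lemma ae_set_integral (D D' : set Omega) (f : Omega -> \bar R) :
  measurable D -> measurable D' -> measurable_fun setT f -> (forall x, 0 <= f x) ->
  {ae P, forall x, D x = D' x} -> \int[P]_(x in D) f x = \int[P]_(x in D') f x.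
Proof.
move=> mD mD' mf f0 DD'; rewrite integral_mkcond [RHS]integral_mkcond.
apply: ge0_ae_eq_integral => //; try exact: restrict_measurable.
- by move=> x _; exact: restrict_ge0.
- by move=> x _; exact: restrict_ge0.
- apply: filterS DD' => x DD' _; rewrite !patchE.
  by congr (if _ then _ else _); apply/idP/idP => /set_mem H; apply/mem_set;
    [rewrite -DD'|rewrite DD'].
Qed.

Lemma Gstar_integral_eq c (f g : Omega -> \bar R) :
  measurable_fun setT f -> measurable_fun setT g ->
  (forall x, 0 <= f x) -> (forall x, 0 <= g x) -> \int[P]_x f x < +oo ->
  (forall s D, (forall V, V \in s -> misses c V) -> measurable D ->
    depends_on [set` s] D -> \int[P]_(x in D) f x = \int[P]_(x in D) g x) ->
  forall D, Gstar F c D -> \int[P]_(x in D) f x = \int[P]_(x in D) g x.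
Proof.
move=> mf mg f0 g0 foo fg D /Gstar_almost_cylinder GD.
suff [] : [set D | measurable D /\ \int[P]_(x in D) f x = \int[P]_(x in D) g x] D by [].
move: D GD; apply: lambda_system_subset => //; first exact: almost_cylinderI.
  apply/dynkin_lambda_system; apply: integral_eq_dynkin => //.
  (* The whole space is a cylinder over the empty list, whence equal total integrals. *)
  by apply: (fg [::]).
move=> D [mD [s [D' [sc mD' dD' DD']]]]; split => //.
by rewrite !(ae_set_integral mD mD' _ _ DD')//; exact: fg dD'.
Qed.

End Gstar_theory.

(** * Existence: a law with the right finite-dimensional laws is Markov *)

Section existence.
Context {R : realType} {T : topologicalType} {A : indexing_collection T}.
Context {d : measure_display} {E : measurableType d}.
Variables (p : transition_family A E R) (p_tsys : is_transition_system p).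
Variable nu : probability E R.
Local Notation Omega := (power_type A E).
Local Notation X := (@coordinate A E : A -> Omega -> E).
Local Notation bot := (Defs.bottom A).
Implicit Types (U V W : A) (s t : seq A) (c : increment A) (D : set Omega).
Variable P : probability Omega R.
Hypothesis P_law : forall s, admissible s ->
  agree_on [set` bot :: s] P (law_probability p nu s).
Local Notation F := (natural_filtration P X).

Definition fine_mean c (h : E -> R) (w : Omega) : R :=
  fine (kernel_mean p c (EFin \o h) w).

Section nonnegative_function.
Variables (h : E -> R) (M : R).
Hypotheses (mh : measurable_fun setT h) (h0 : forall x, 0 <= h x)
  (hM : forall x, h x <= M).

Let mEh : measurable_fun setT (EFin \o h).
Proof. exact/measurable_EFinP. Qed.

Let h0E x : (0 <= (EFin \o h) x)%E.
Proof. by rewrite lee_fin. Qed.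

Lemma kernel_mean_le c w : (kernel_mean p c (EFin \o h) w <= M%:E)%E.
Proof.
apply: (@le_trans _ _ (\int[p c (incr_restr c w)]_y (cst M%:E y))%E).
  by apply: ge0_le_integral => // x _; rewrite lee_fin// (le_trans (h0 x)).
by rewrite integral_cst// prob_kernel mule1.
Qed.

Lemma fine_meanK c w : (fine_mean c h w)%:E = kernel_mean p c (EFin \o h) w.
Proof.
rewrite fineK// ge0_fin_numE; last exact: kernel_mean_ge0.
by apply: le_lt_trans (kernel_mean_le c w) _; rewrite ltry.
Qed.

Lemma measurable_fine_mean c : measurable_fun [set: Omega] (fine_mean c h).
Proof. by apply: measurableT_comp => //; exact: measurable_kernel_mean. Qed.

Lemma fine_mean_depends_on c : depends_on (incr_index c) (fine_mean c h).
Proof.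
by move=> x y xy; rewrite /fine_mean (kernel_mean_depends_on p (EFin \o h) xy).
Qed.

Lemma fine_mean_bound c w : 0 <= fine_mean c h w <= M.
Proof.
by rewrite -!lee_fin fine_meanK kernel_mean_le andbT kernel_mean_ge0.
Qed.

Lemma integral_fine_mean c D : Gstar F c D ->
  (\int[P]_(w in D) (fine_mean c h w)%:E = \int[P]_(w in D) (h (X (outer c) w))%:E)%E.
Proof.
move=> GD; under eq_integral do rewrite fine_meanK.
apply/esym/(@Gstar_integral_eq _ _ _ _ _ P c) => //.
- exact: (measurableT_comp mEh (measurable_coordinate _)).
- exact: measurable_kernel_mean.
- by move=> x; rewrite lee_fin.
- by move=> x; exact: kernel_mean_ge0.
- apply: (@le_lt_trans _ _ (\int[P]_x (cst M%:E x))%E).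
    apply: ge0_le_integral => //; first by move=> x _; rewrite lee_fin.
    + exact: (measurableT_comp mEh (measurable_coordinate _)).
    + by move=> x _; rewrite lee_fin// (le_trans (h0 (x (outer c)))).
  by rewrite integral_cst//= probability_setT mule1 ltry.
- move=> s D' sc mD' dD'.
  exact: (cylinder_markov p_tsys P_law sc mD' dD' mEh).
Qed.

End nonnegative_function.

Lemma bounded_integrable (Y : Omega -> R) (K : R) :
  measurable_fun setT Y -> (forall w, `|Y w| <= K) ->
  P.-integrable setT (EFin \o Y).
Proof.
move=> mY YK; apply: measurable_bounded_integrable => //.
  by rewrite (le_lt_trans (probability_le1 P measurableT)) ?ltry.
exists K; split; first exact: num_real.
by move=> x Kx w _; apply: le_trans (YK w) (ltW Kx).
Qed.

(* f is shifted to f + M >= 0, for which the functional identities hold. *)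
Lemma is_cond_exp_Gstar c (f : E -> R) (M : R) (G : set (set Omega)) :
  measurable_fun setT f -> (forall x, `|f x| <= M) ->
  (forall Z : Omega -> R, measurable_fun setT Z -> depends_on (incr_index c) Z ->
     forall B : set R, measurable B -> G (Z @^-1` B)) ->
  G `<=` Gstar F c ->
  is_cond_exp P G (f \o X (outer c))
    (fun w => fine_mean c (fun y => f y + M) w - M).
Proof.
move=> mf fM GZ GF; pose h y := f y + M.
have mh : measurable_fun setT h by exact: measurable_funD.
have h0 x : 0 <= h x by have := fM x; rewrite ler_norml -subr_ge0 opprK => /andP[].
have hM x : h x <= M + M by rewrite lerD2r; have := fM x; rewrite ler_norml => /andP[].
have mY : measurable_fun setT (fun w : Omega => fine_mean c h w - M).
  by apply: measurable_funB => //; exact: measurable_fine_mean.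
have YM w : `|fine_mean c h w - M| <= M.
  have /andP[Y0 Y1] := fine_mean_bound mh h0 hM c w.
  by rewrite ler_norml lerBlDr Y1 lerBrDr addNr Y0.
split.
- apply: GZ => // x y xy; congr (_ - _).
  exact: (fine_mean_depends_on h xy).
- exact: bounded_integrable YM.
move=> D GD; have GFD := GF _ GD; have mD := Gstar_measurable GFD.
have sub (Z : Omega -> R) K : measurable_fun setT Z -> (forall w, `|Z w| <= K) ->
    (\int[P]_(w in D) (Z w - M)%:E = \int[P]_(w in D) (Z w)%:E - \int[P]_(w in D) M%:E)%E.
  move=> mZ ZK; rewrite -integralB_EFin//.
  - by apply: integrableS (bounded_integrable mZ ZK).
  - by apply: finite_measure_integrable_cst.
rewrite (@sub (fine_mean c h) (M + M)).
- rewrite (integral_fine_mean mh h0 hM GFD) -(@sub _ (M + M)).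
  + by apply: eq_integral => w _; rewrite /h /= addrK.
  + exact: (measurableT_comp mh (measurable_coordinate _)).
  + by move=> w; rewrite ger0_norm.
- exact: measurable_fine_mean.
- by move=> w; have /andP[Y0 Y1] := fine_mean_bound mh h0 hM c w; rewrite ger0_norm.
Qed.

Lemma sigma_of_Gstar c : sigma_of (incr_index c) X `<=` Gstar F c.
Proof.
apply: smallest_sub; first exact: smallest_sigma_algebra.
move=> _ [V /incr_index_misses cV [B mB <-]]; rewrite setTI.
exact: Gstar_coordinate.
Qed.

Lemma law_is_Markov : is_Markov_law nu p P.
Proof.
have mZB (Z : Omega -> R) (B : set R) : measurable_fun setT Z -> measurable B ->
    measurable (Z @^-1` B).
  by move=> mZ mB; rewrite -[X in measurable X]setTI; exact: mZ.
have dZB (Z : Omega -> R) (B : set R) G : depends_on G Z -> depends_on G (Z @^-1` B).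
  by move=> dZ x y xy; rewrite /preimage/= (dZ x y).
split.
- split=> [V B mB|c f mf [M fM]].
    apply: sub_sigma_algebra; left; exists V => //; exists B => //.
    by rewrite setTI.
  (* One version serves both conditional expectations: it depends on the coordinates in A_C only,
     and all of these miss [c]. *)
  exists (fun w => fine_mean c (fun y => f y + M) w - M).
    apply: is_cond_exp_Gstar => //; last exact: sigma_of_Gstar.
    by move=> Z mZ dZ B mB; apply: depends_on_sigma_of; [exact: mZB|exact: dZB].
  exists (fun w => fine_mean c (fun y => f y + M) w - M); last exact: ae_eq_refl.
  apply: is_cond_exp_Gstar => // Z mZ dZ B mB.
  by apply: (@Gstar_cylinder _ _ _ _ _ _ _ (incr_index c));
    [exact: incr_index_misses|exact: mZB|exact: dZB].
- move=> B mB.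
  have mXB : measurable (X bot @^-1` B : set Omega).
    by rewrite -[Y in measurable Y]setTI; exact: measurable_coordinate.
  have dXB : depends_on [set` [:: bot]] (X bot @^-1` B : set Omega).
    by move=> x y xy; rewrite /preimage/= /coordinate xy//= mem_seq1.
  rewrite (P_law (s := [::]) Logic.I mXB dXB).
  rewrite -[LHS]/(nu (update (point : Omega) bot @^-1` (X bot @^-1` B))).
  congr (nu _); apply/seteqP.
  by split => y; rewrite /preimage/= /coordinate update_same.
- move=> c B mB.
  (* For an indicator the bound is [1]; the mean of the added constant is subtracted again, and the
     kernel itself remains. *)
  have YE : (fun w => fine_mean c (fun y => \1_B y + 1) w - 1) =
      (fun w => fine (p c (incr_restr c w) B)).
    apply/funext => w; rewrite /fine_mean /kernel_mean.
    under eq_integral do rewrite /= EFinD.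
    rewrite ge0_integralD//; [|exact/measurable_EFinP..].
    rewrite integral_indic// setIT integral_cst//= prob_kernel mule1 fineD//.
      by rewrite addrK.
    rewrite ge0_fin_numE// (le_lt_trans (probability_le1 (kernel_probability (p c) _) mB))//.
    by rewrite ltry.
  exists (fun w => fine_mean c (fun y => \1_B y + 1) w - 1).
    apply: (@is_cond_exp_Gstar c (\1_B : E -> R)) => //.
    + by move=> x; rewrite ger0_norm indicE//; case: (_ \in _).
    + move=> Z mZ dZ B' mB'; apply: (@Gstar_cylinder _ _ _ _ _ _ _ (incr_index c)).
      * exact: incr_index_misses.
      * exact: mZB.
      * exact: dZB.
  by apply: nearW => w _; exact: (congr1 (fun Z => Z w) YE).
Qed.

End existence.

(** * Uniqueness *)

Section uniqueness.
Context {R : realType} {T : topologicalType} {A : indexing_collection T}.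
Context {d : measure_display} {E : measurableType d}.
Variables (p : transition_family A E R) (p_tsys : is_transition_system p).
Variable nu : probability E R.
Local Notation Omega := (power_type A E).
Local Notation X := (@coordinate A E : A -> Omega -> E).
Local Notation bot := (Defs.bottom A).
Implicit Types (U V W : A) (s t : seq A) (c : increment A) (D : set Omega).

Lemma incr_of_misses U s V : V \in bot :: s -> misses (incr_of U s) V.
Proof.
move=> Vs; rewrite /misses incr_of_set; apply/seteqP; split => // x [Vx [_]].
by apply; exists V.
Qed.

(** Only the coordinate [U] is split off, with an arbitrary event in all others: the induction adds
    one coordinate at a time. *)
Definition rectangle U D : Prop := exists B D0, [/\ measurable B, measurable D0,
  depends_on [set V | V <> U] D0 & D = (X U @^-1` B) `&` D0].

Lemma rectangleI U : setI_closed (rectangle U).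
Proof.
move=> _ _ [B1 [D1 [mB1 mD1 dD1 ->]]] [B2 [D2 [mB2 mD2 dD2 ->]]].
exists (B1 `&` B2), (D1 `&` D2); split; [exact: measurableI|exact: measurableI| |].
  by move=> x y xy; rewrite /setI/= (dD1 x y)// (dD2 x y).
by rewrite preimage_setI setIACA.
Qed.

Lemma measurable_coordinate_preimage U (B : set E) :
  measurable B -> measurable (X U @^-1` B).
Proof.
by move=> mB; rewrite -[Y in measurable Y]setTI; exact: measurable_coordinate.
Qed.

Lemma sigma_rectangle U : <<s rectangle U >> = @measurable _ Omega.
Proof.
apply/seteqP; split.
  apply: smallest_sub; first exact: sigma_algebra_measurable.
  move=> _ [B [D [mB mD _ ->]]]; apply: measurableI => //.
  exact: measurable_coordinate_preimage.
apply: smallest_sub; first exact: smallest_sigma_algebra.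
move=> _ [V _ [B mB <-]]; rewrite setTI; apply: sub_sigma_algebra.
have [->|VU] := pselect (V = U).
  by exists B, setT; split => //; rewrite setIT.
exists setT, (X V @^-1` B); split => //.
- exact: measurable_coordinate_preimage.
- by move=> x y xy; rewrite /preimage/= /coordinate xy.
- by rewrite preimage_setT setTI.
Qed.

Variable Q : probability Omega R.
Hypothesis Q_Markov : is_Markov_law nu p Q.

(** [D] belongs to [Gstar] of the increment, so the prescribed conditional probability replaces the
    event on [X U] by a kernel mean. That integrand sees [bot :: s] only, where [Q] is already
    identified, and one step of [law] read backwards restores the event. *)
Lemma Markov_law_rectangle U s (B : set E) D : admissible (U :: s) ->
  agree_on [set` bot :: s] Q (law_probability p nu s) ->
  measurable B -> measurable D -> depends_on [set` bot :: s] D ->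
  Q ((X U @^-1` B) `&` D) = law_probability p nu (U :: s) ((X U @^-1` B) `&` D).
Proof.
move=> adm agr mB mD dD; pose c := incr_of U s.
have [_ _ /(_ c B mB)[Y [mY iY eY] YE]] := Q_Markov.
have mXB := measurable_coordinate_preimage U mB.
have GD : Gstar (natural_filtration Q X) c D.
  by apply: Gstar_cylinder dD => // V Vs; exact: incr_of_misses.
pose g := EFin \o \1_B : E -> \bar R.
have mg : measurable_fun setT g by exact/measurable_EFinP.
have g0 y : (0 <= g y)%E by rewrite lee_fin.
have gE w : ((fine (p c (incr_restr c w) B))%:E = kernel_mean p c g w)%E.
  rewrite /kernel_mean integral_indic// setIT fineK//.
  rewrite ge0_fin_numE// (le_lt_trans (probability_le1 (kernel_probability (p c) _) mB))//.
  by rewrite ltry.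
have mk := measurable_kernel_mean p c mg g0.
have k0 x := kernel_mean_ge0 p c x g0.
have nk : nn_measurable (kernel_mean p c g \_ D).
  by split; [exact: restrict_measurable|move=> x; exact: restrict_ge0].
transitivity (\int[Q]_(w in D) (\1_(X U @^-1` B) w)%:E)%E.
  by rewrite integral_indic.
rewrite -eY//.
transitivity (\int[Q]_(w in D) kernel_mean p c g w)%E.
  apply: ae_eq_integral => //.
  - apply/measurable_EFinP; apply: measurable_funTS => _ S mS; rewrite setTI.
    exact: Gstar_measurable (mY S mS).
  - exact: measurable_funTS.
  - by apply: filterS YE => w YE _; rewrite YE//.
rewrite integral_mkcond.
have dk : depends_on [set` bot :: s] (kernel_mean p c g \_ D).
  apply: restrict_depends_on => //.
  by apply: depends_onS (kernel_mean_depends_on p g); exact: incr_of_index.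
rewrite (agree_on_integral agr nk.1 nk.2 dk).
have nphi : nn_measurable ((fun w : Omega => g (w U)) \_ D).
  split; last by move=> x; exact: restrict_ge0.
  by apply: restrict_measurable => //; exact: (measurableT_comp mg (measurable_coordinate U)).
have Us : ~ [set` bot :: s] U by case: adm => _ /negP.
transitivity (expect p nu (U :: s) ((fun w : Omega => g (w U)) \_ D)).
  rewrite (expect_cons p nu U s nphi); apply: eq_integral => x _.
  by rewrite (@resample_restrict _ _ _ _ _ p c g D [set` bot :: s]).
by rewrite /expect -integral_mkcond integral_indic.
Qed.

Lemma Markov_law_agrees s : admissible s ->
  agree_on [set` bot :: s] Q (law_probability p nu s).
Proof.
elim: s => [_|U s IH adm] S mS dS.
  have SE : S = X bot @^-1` (update (point : Omega) bot @^-1` S).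
    apply/funext => x; apply: dS => V Vb.
    by have /eqP -> : V == bot by [rewrite -mem_seq1]; rewrite update_same.
  have [_ Q0 _] := Q_Markov.
  rewrite {1}SE Q0//; rewrite -[Y in measurable Y]setTI.
  exact: (measurable_update2 (point : Omega) bot).
(* The images under [freeze F] can be compared on the whole sigma-field, and on an event depending
   on [F] only they return the original values. *)
pose F := [set` [:: bot, U & s]].
have fS : freeze F @^-1` S = S := freezeK dS.
rewrite -{1}fS -{2}fS.
apply: (@measure_unique _ _ _ (rectangle U) (fun=> setT) _ _ _ _
  (image_probability Q (measurable_freeze F))
  (image_probability (law_probability p nu (U :: s)) (measurable_freeze F))) => //.
- by rewrite sigma_rectangle.
- exact: rectangleI.
- by move=> _; exists setT, setT; split => //; rewrite preimage_setT setTI.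
- by rewrite bigcup_const//; exists 0%N.
- move=> _ [B [D [mB mD dD ->]]].
  rewrite -[LHS]/(Q (freeze F @^-1` ((X U @^-1` B) `&` D))).
  rewrite -[RHS]/(law_probability p nu (U :: s) (freeze F @^-1` ((X U @^-1` B) `&` D))).
  rewrite preimage_setI.
  have -> : freeze F @^-1` (X U @^-1` B) = X U @^-1` B.
    have FU : F U by rewrite /F /= in_cons2 eqxx.
    by apply/seteqP; split => x; rewrite /preimage/= /coordinate freezeE.
  apply: Markov_law_rectangle => //.
  + exact: IH (admissible_tail adm).
  + rewrite -[Y in measurable Y]setTI; exact: measurable_freeze.
  + move=> x y xy; apply: dD => V VU; rewrite /freeze; case: asboolP => //.
    by rewrite /F /= in_cons2 => /predU1P[//|]; exact: xy.
- by move=> _; rewrite (le_lt_trans (probability_le1 _ _)) ?ltry.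
Qed.

End uniqueness.

(** * Consistency of the finite-dimensional laws, and conclusion *)

Section consistency.
Context {R : realType} {T : topologicalType} {A : indexing_collection T}.
Context {d : measure_display} {E : measurableType d}.
Variables (p : transition_family A E R) (p_tsys : is_transition_system p).
Variable nu : probability E R.
Local Notation bot := (Defs.bottom A).

(** In general neither list contains the other; both laws are marginals of the law of an admissible
    list containing both. *)
Lemma law_consistent (s r t : seq A) (S : set (power_type A E)) :
  admissible r -> admissible t -> {subset s <= bot :: r} ->
  {subset s <= bot :: t} -> measurable S -> depends_on [set` s] S ->
  law_probability p nu r S = law_probability p nu t S.
Proof.
move=> admr admt sr st mS dS; have [u admu rtu] := admissible_cover (r ++ t).
suff cons v : admissible v -> {subset v <= r ++ t} -> {subset s <= bot :: v} ->
    law_probability p nu u S = law_probability p nu v S.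
  rewrite -(cons r)// -?(cons t)// => V Vv; rewrite mem_cat Vv ?orbT//.
move=> admv vrt sv.
have lawE w : law_probability p nu w S = expect p nu w (EFin \o \1_S).
  by rewrite /expect integral_indic// setIT.
rewrite !lawE; apply: (expect_consistent p_tsys) => //.
- move=> V Vv; have := rtu V (vrt V Vv); rewrite in_cons => /predU1P[Vb|//].
  by move: (admissible_bot admv); rewrite -Vb Vv.
- move=> x y xy; rewrite /= !indicE (_ : (x \in S) = (y \in S))//.
  by apply: (depends_on_mem dS) => V Vs; exact/xy/sv.
- by split; [exact/measurable_EFinP|move=> x; rewrite lee_fin].
Qed.

End consistency.

Theorem theorem2p2 (R : realType)
    (T : metricType R) (T_lc : locally_compact [set: T])
    (E : pmetricType R) (E_lc : locally_compact [set: E])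
    (E_sep : separable_space E)
    (A : indexing_collection T)
    (p : transition_family A (borel_type E) R)
    (p_tsys : is_transition_system p)
    (nu : probability (borel_type E) R) :
  exists P : probability (power_type A (borel_type E)) R,
    is_Markov_law nu p P /\
    (forall Q : probability (power_type A (borel_type E)) R,
       is_Markov_law nu p Q ->
       forall S : set (power_type A (borel_type E)),
         measurable S -> Q S = P S).
Proof.
(* The extension theorem asks for a law for every finite list, admissible or not. Any admissible
   list covering it may be chosen, by [law_consistent]. *)
pose cover (s : seq A) := cid2 (admissible_cover s).
pose mu (s : seq A) : probability (power_type A (borel_type E)) R :=
  law_probability p nu (s2val (cover s)).
have cover_adm s : admissible (s2val (cover s)) by exact: (s2valP (cover s)).
have cover_sub s : {subset s <= Defs.bottom A :: s2val (cover s)} by exact: (s2valP' (cover s)).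
have [|P PE] := kolmogorov_extension (mu := mu) E_lc E_sep.
  move=> s t S st mS dS; apply: (law_consistent p_tsys nu _ _ _ _ mS dS) => //.
  by move=> V /st; exact: cover_sub.
have P_law (s : seq A) : admissible s ->
    agree_on [set` Defs.bottom A :: s] P (law_probability p nu s).
  move=> adms S mS dS; rewrite (PE (Defs.bottom A :: s))//.
  by apply: (law_consistent p_tsys nu _ _ _ _ mS dS).
exists P; split; first exact: law_is_Markov.
move=> Q QM S mS.
(* Cylinders form a generating pi-system, and on each of them a Markov law takes the value of a
   finite-dimensional law. *)
apply: (@measure_unique _ _ _ cylinder (fun=> setT)) => //.
- by rewrite sigma_cylinder.
- exact: (@measurableI _ (cylinder_type A (borel_type E))).
- by move=> _; exact: (@measurableT _ (cylinder_type A (borel_type E))).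
- by rewrite bigcup_const//; exists 0%N.
- move=> D [mD [F [/finite_seqP[s ->] dD]]].
  have [t admt st] := admissible_cover s.
  have dDt : depends_on [set` Defs.bottom A :: t] D.
    by apply: depends_onS dD => V; exact: st.
  transitivity (law_probability p nu t D).
    exact: (Markov_law_agrees QM admt mD dDt).
  exact/esym/(P_law t admt D mD dDt).
- by move=> _; rewrite (le_lt_trans (probability_le1 _ _)) ?ltry.
Qed.
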